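(* Let $1\le p<\infty$ and $\mathbf{T}=(T_1,\dots,T_d)=(V_1P,\dots,V_dP)\in\mathfrak{C}_p^d(\mathcal{H})$ (canonical spherical polar decomposition). Then $$\omega_{s,p}(\mathbf{T})\le\|\mathbf{T}\|_{s,h,p}\le\|\mathbf{T}\|_{s,p}.$$
   Context: $\mathcal{H}$ is a separable complex Hilbert space, $d\in\mathbb{N}$, and $\mathfrak{C}_p(\mathcal{H})$ is the Schatten $p$-class with norm $\|T\|_p=[\mathrm{tr}(|T|^p)]^{1/p}$. For a tuple $\mathbf{T}=(T_1,\dots,T_d)$ of bounded operators on $\mathcal{H}$ put $P=\sqrt{T_1^*T_1+\cdots+T_d^*T_d}$. For $1\le p<\infty$, $\mathbf{T}\in\mathfrak{C}_p^d(\mathcal{H})$ means $\mathrm{tr}(P^p)<\infty$, and the spherical Schatten $p$-norm is $\|\mathbf{T}\|_{s,p}=[\mathrm{tr}(P^p)]^{1/p}$. The canonical spherical polar decomposition is $T_i=V_iP$, $i=1,\dots,d$, where the column operator $(V_1,\dots,V_d):\mathcal{H}\to\mathcal{H}^d$ is the partial isometry with initial space $\mathcal{N}(P)^\perp$, i.e. $\sum_{i=1}^dV_i^*V_i$ is the orthogonal projection onto $\mathcal{N}(P)^\perp$. Let $\overline{\mathbb{B}_d}=\{\boldsymbol{\lambda}=(\lambda_1,\dots,\lambda_d)\in\mathbb{C}^d:\sum_{k=1}^d|\lambda_k|^2\le1\}$. For $T\in\mathfrak{C}_p(\mathcal{H})$, $\omega_p(T)=\sup_{\theta\in\mathbb{R}}\|\Re(e^{i\theta}T)\|_p$,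 where $\Re(T)=\frac{T+T^*}{2}$. The (joint) Schatten $p$-numerical radius is $\omega_{s,p}(\mathbf{T})=\sup_{\boldsymbol{\lambda}\in\overline{\mathbb{B}_d}}\omega_p(\lambda_1T_1+\cdots+\lambda_dT_d)$, and the Schatten hypo-$p$-norm is $\|\mathbf{T}\|_{s,h,p}=\sup_{\boldsymbol{\lambda}\in\overline{\mathbb{B}_d}}\|\lambda_1T_1+\cdots+\lambda_dT_d\|_p$. *)

(* Defs.v *)
From HB Require Import structures.
From mathcomp Require Import all_boot all_order all_algebra.
From mathcomp Require Import all_classical all_reals all_analysis.
From mathcomp.real_closed Require Export complex.

Set Implicit Arguments.
Unset Strict Implicit.
Unset Printing Implicit Defensive.

Import Order.TTheory GRing.Theory Num.Theory.
Import numFieldNormedType.Exports.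

Local Open Scope classical_set_scope.
Local Open Scope complex_scope.
Local Open Scope ring_scope.

(* The inner product is linear in its first argument and conjugate-linear in
   its second one; completeness is that of the norm of the inner product. *)
HB.mixin Record isHilbert (R : realType) H
    of CompleteNormedModule R[i] H := {
  hdot : {dot H for (@Num.conj R[i])} ;
  hnormE : forall x : H, `|x| ^+ 2 = hdot x x }.

#[short(type="hilbertType")]
HB.structure Definition Hilbert (R : realType) :=
  {H of isHilbert R H & CompleteNormedModule R[i] H}.

Definition separable_space (T : topologicalType) :=
  exists2 S : set T, countable S & dense S.

Section operators.
Context {R : realType} {H : hilbertType R}.
Implicit Types (x y e : H) (A B S T : H -> H) (E F : set H) (p : R) (d : nat).

Definition inner x y : R[i] := (@hdot R H) x y.

Definition bounded_op T :=
  linear T /\ exists M : R, forall x, `|T x| <= M%:C * `|x|.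

Definition positive_op T := bounded_op T /\ forall x, 0 <= inner (T x) x.

(* In the definitions by xget below, the default value is never reached on the
   arguments of interest: adjoints of bounded operators, positive square roots
   and real powers of positive operators exist and are unique. *)
Definition adjoint T : H -> H :=
  xget 0 [set S | forall x y, inner (T x) y = inner x (S y)].

Definition op_sqrt A : H -> H :=
  xget 0 [set S | positive_op S /\ S \o S = A].

Definition op_abs T : H -> H := op_sqrt (adjoint T \o T).

Definition op_poly (q : {poly R}) A : H -> H :=
  fun x => \sum_(k < size q) (q`_k)%:C *: iter k A x.

(* Continuous functional calculus B = f(A) of a positive operator A: B is the
   limit in operator norm (uniform convergence on the unit ball) of q_n(A), for
   real polynomials q_n tending to f uniformly on [0, M], where M >= ||A||, so
   that [0, M] contains the spectrum of A. *)
Definition is_fun_calc (f : R -> R) A B :=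
  bounded_op B /\
  exists (M : R) (q : nat -> {poly R}),
    [/\ forall x, `|A x| <= M%:C * `|x|,
        {uniform `[0, M], (fun n t => (q n).[t]) @ \oo --> f} &
        {uniform [set x : H | `|x| <= 1],
           (fun n => op_poly (q n) A) @ \oo --> B}].

Definition op_pow A p : H -> H := xget 0 [set B | is_fun_calc (fun t => t `^ p) A B].

Definition orthonormal_basis E :=
  [/\ forall e, E e -> inner e e = 1,
      forall e e', E e -> E e' -> e != e' -> inner e e' = 0 &
      forall x, (forall e, E e -> inner x e = 0) -> x = 0].

(* Trace of a positive operator, with value +oo outside the trace class; it
   does not depend on the orthonormal basis picked by xget. *)
Definition trace A : \bar R :=
  \esum_(e in xget set0 orthonormal_basis) (complex.Re (inner (A e) e))%:E.

Definition schatten_norm p T : \bar R :=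
  poweR (trace (op_pow (op_abs T) p)) p^-1.

Definition op_re T : H -> H := fun x => 2^-1 *: (T x + adjoint T x).

Definition numerical_radius p T : \bar R :=
  ereal_sup [set schatten_norm p (op_re (fun x => (cos t +i* sin t) *: T x))
            | t in [set: R]].

Definition orthocompl F : set H := [set y | forall x, F x -> inner y x = 0].

Definition is_orthoproj F T :=
  forall x, F (T x) /\ orthocompl F (x - T x).

Definition op_kernel T : set H := [set x | T x = 0].

Definition complex_ball d : set ('I_d -> R[i]) :=
  [set l | \sum_(k < d) `|l k| ^+ 2 <= 1].

Definition lin_comb d (l : 'I_d -> R[i]) (T : 'I_d -> H -> H) : H -> H :=
  fun x => \sum_(k < d) l k *: T k x.

Definition gram d (T : 'I_d -> H -> H) : H -> H :=
  fun x => \sum_(i < d) adjoint (T i) (T i x).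

Definition spherical_modulus d (T : 'I_d -> H -> H) : H -> H :=
  op_sqrt (gram T).

Definition spherical_schatten_class p d (T : 'I_d -> H -> H) :=
  (forall i, bounded_op (T i)) /\
  (trace (op_pow (spherical_modulus T) p) < +oo)%E.

Definition spherical_schatten_norm p d (T : 'I_d -> H -> H) : \bar R :=
  poweR (trace (op_pow (spherical_modulus T) p)) p^-1.

Definition spherical_polar_decomposition d (T V : 'I_d -> H -> H) (P : H -> H) :=
  [/\ P = spherical_modulus T,
      forall i, bounded_op (V i),
      forall i, T i = V i \o P &
      is_orthoproj (orthocompl (op_kernel P)) (gram V)].

Definition joint_numerical_radius p d (T : 'I_d -> H -> H) : \bar R :=
  ereal_sup [set numerical_radius p (lin_comb l T) | l in complex_ball (d := d)].

Definition hypo_norm p d (T : 'I_d -> H -> H) : \bar R :=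
  ereal_sup [set schatten_norm p (lin_comb l T) | l in complex_ball (d := d)].

End operators.

(* Main.v *)
Require Import Defs.
From mathcomp Require Import all_boot all_order all_algebra.
From mathcomp Require Import all_classical all_reals all_analysis.
From mathcomp Require Import finmap ring lra.

(** Why the inequalities hold. Fix l in the closed unit ball of C^d and put
    S = sum l_k T_k. Finiteness of tr(P^p) makes P compact ([trace_pow_compact]),
    and the Cauchy-Schwarz inequality in C^d gives
    |S x|^2 <= sum |T_k x|^2 = |P x|^2, so that S is dominated by P
    ([lin_comb_le_modulus]) and compact as well.

    Everything then follows from one estimate, [dominated_pow_sum]: if B is
    positive and compact and |S x| <= |B x| for all x, then
    sum_i |<S u_i, v_i>|^p <= tr(B^p) for all orthonormal families u and v.
    Expanding in an eigenbasis of B bounds each |<S u_i, v_i>| by an average of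
    eigenvalues of B with doubly substochastic weights, and t^p is convex.
    - For B = P, with u and v the singular vectors of S, the sum is tr(|S|^p)
      ([singular_values]); this is the second inequality.
    - For B = |S|, with u and v the singular vectors of A = Re(e^(it) S), each
      singular value <A u_i, v_i> is at most the mean of |<S u_i, v_i>| and
      |<S v_i, u_i>|, so convexity and two uses of the estimate give
      tr(|A|^p) <= tr(|S|^p); this is the first inequality.

    The operator theory behind it is built from the completeness of H: adjoints
    from a Riesz representation theorem ([riesz_subspace]); square roots and
    real powers as limits of polynomials ([fun_calc_ex]), where positivity of
    q(A) for q >= 0 on [0, M] comes from approximate eigenvalues
    ([op_poly_ge0]) and the polynomials from Bernstein's proof of the Weierstrass
    theorem ([weierstrass]); eigenbases of compact positive operators
    ([spectral_basis]); and the independence of the trace from the basis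
    ([trace_basis]). *)

Set Implicit Arguments.
Unset Strict Implicit.
Unset Printing Implicit Defensive.

Import Order.TTheory GRing.Theory Num.Theory.
Import numFieldNormedType.Exports.

Local Open Scope classical_set_scope.
Local Open Scope ring_scope.
Local Open Scope complex_scope.

(** * Real-valued norms and the inner product *)

(** Norms on complex spaces take values in the partially ordered field R[i];
    the real number that represents such a norm is what can be compared,
    minimised and fed to real analysis. *)
Definition nrm {R : realType} {V : normedZmodType R[i]} (v : V) : R :=
  complex.Re `|v|.

Section real_norm.
Context {R : realType}.

Section normed_group.
Context {V : normedZmodType R[i]}.
Implicit Types v w : V.

Lemma norm_nrm v : `|v| = (nrm v)%:C.
Proof. by rewrite /nrm RRe_real// normr_real. Qed.

Lemma nrm_ge0 v : 0 <= nrm v.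
Proof. by rewrite -ler0c -norm_nrm. Qed.

Lemma nrm_eq0 v : (nrm v == 0) = (v == 0).
Proof. by rewrite -(normr_eq0 v) norm_nrm -(inj_eq (@complexI R)). Qed.

Lemma nrm0 : nrm (0 : V) = 0.
Proof. by apply/eqP; rewrite nrm_eq0. Qed.

Lemma ler_nrmD v w : nrm (v + w) <= nrm v + nrm w.
Proof. by rewrite -lecR rmorphD/= -!norm_nrm ler_normD. Qed.

Lemma nrmN v : nrm (- v) = nrm v.
Proof. by rewrite /nrm normrN. Qed.

Lemma nrm_distC v w : nrm (v - w) = nrm (w - v).
Proof. by rewrite -nrmN opprB. Qed.

Lemma ler_nrmB v w : nrm (v - w) <= nrm v + nrm w.
Proof. by rewrite -(nrmN w) ler_nrmD. Qed.

Lemma ler_nrm_sum (I : Type) (r : seq I) (P : pred I) (F : I -> V) :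
  nrm (\sum_(i <- r | P i) F i) <= \sum_(i <- r | P i) nrm (F i).
Proof.
elim/big_ind2 : _ => //[|x a y b xa yb]; first by rewrite nrm0.
by rewrite (le_trans (ler_nrmD _ _))// lerD.
Qed.

End normed_group.

Implicit Types (z : R[i]) (a : R).

Lemma nrmM z1 z2 : nrm (z1 * z2) = nrm z1 * nrm z2.
Proof. by apply: complexI; rewrite rmorphM/= -!norm_nrm normrM. Qed.

Lemma nrm_real a : nrm a%:C = `|a|.
Proof. by rewrite /nrm normc_def/= expr0n addr0 sqrtr_sqr. Qed.

Lemma real_complexV a : (a^-1)%:C = a%:C^-1.
Proof. exact: fmorphV. Qed.

Lemma conjcM z1 z2 : conjc (z1 * z2) = conjc z1 * conjc z2.
Proof. exact: rmorphM. Qed.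

Lemma nrm_conjc z : nrm (conjc z) = nrm z.
Proof. by rewrite /nrm normcJ. Qed.

Lemma Re_le_nrm z : complex.Re z <= nrm z.
Proof.
by rewrite -lecR -norm_nrm (le_trans _ (normc_ge_Re z))// lecR ler_norm.
Qed.

Lemma mulcJ z : z * conjc z = (nrm z ^+ 2)%:C.
Proof. by rewrite rmorphXn/= -norm_nrm sqr_normc. Qed.

Lemma ReD z1 z2 : complex.Re (z1 + z2) = complex.Re z1 + complex.Re z2.
Proof. exact: raddfD. Qed.

Lemma ReB z1 z2 : complex.Re (z1 - z2) = complex.Re z1 - complex.Re z2.
Proof. exact: raddfB. Qed.

Lemma Re_sum (I : Type) (r : seq I) (P : pred I) (F : I -> R[i]) :
  complex.Re (\sum_(i <- r | P i) F i) = \sum_(i <- r | P i) complex.Re (F i).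
Proof. exact: raddf_sum. Qed.

Lemma nrm_sqrE z : nrm z ^+ 2 = complex.Re z ^+ 2 + complex.Im z ^+ 2.
Proof. by apply: complexI; rewrite add_Re2_Im2 rmorphXn/= -norm_nrm. Qed.

Lemma nrmZ (V : normedModType R[i]) z (v : V) : nrm (z *: v) = nrm z * nrm v.
Proof. by apply: complexI; rewrite rmorphM/= -!norm_nrm normrZ. Qed.

Lemma le_of_sqr a b : 0 <= b -> a ^+ 2 <= b ^+ 2 -> a <= b.
Proof.
move=> b0; have [a0|a0 _] := leP 0 a; first by rewrite ler_sqr.
exact: le_trans (ltW a0) b0.
Qed.

Lemma eq0_le_eps a : (forall e, 0 < e -> a <= e) -> a <= 0.
Proof.
by move=> ae; apply/ler_addgt0Pr => e e0; rewrite add0r ae.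
Qed.

End real_norm.

Section inner_product.
Context {R : realType} {H : hilbertType R}.
Implicit Types (x y v w : H) (z : R[i]).

Lemma innerC x y : inner x y = conjc (inner y x).
Proof. by rewrite /inner hermC expr0 mul1r. Qed.

Lemma innerDl x y w : inner (x + y) w = inner x w + inner y w.
Proof. exact: linearDl. Qed.

Lemma innerZl z x w : inner (z *: x) w = z * inner x w.
Proof. exact: linearZl_LR. Qed.

Lemma innerDr x y w : inner w (x + y) = inner w x + inner w y.
Proof. exact: linearDr. Qed.

Lemma innerZr z x w : inner w (z *: x) = conjc z * inner w x.
Proof. exact: linearZr_LR. Qed.

Lemma innerNl x w : inner (- x) w = - inner x w.
Proof. exact: linearNl. Qed.

Lemma innerNr x w : inner w (- x) = - inner w x.
Proof. exact: linearNr. Qed.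

Lemma innerBl x y w : inner (x - y) w = inner x w - inner y w.
Proof. by rewrite innerDl innerNl. Qed.

Lemma innerBr x y w : inner w (x - y) = inner w x - inner w y.
Proof. by rewrite innerDr innerNr. Qed.

Lemma inner0l w : inner 0 w = 0.
Proof. exact: linear0l. Qed.

Lemma inner0r w : inner w 0 = 0.
Proof. exact: linear0r. Qed.

Lemma inner_suml (I : Type) (r : seq I) (P : pred I) (F : I -> H) w :
  inner (\sum_(i <- r | P i) F i) w = \sum_(i <- r | P i) inner (F i) w.
Proof. exact: linear_sumlz. Qed.

Lemma inner_sumr (I : Type) (r : seq I) (P : pred I) (F : I -> H) w :
  inner w (\sum_(i <- r | P i) F i) = \sum_(i <- r | P i) inner w (F i).
Proof. exact: linear_sumr. Qed.

Lemma inner_nrm x : inner x x = (nrm x ^+ 2)%:C.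
Proof. by rewrite /inner -hnormE norm_nrm rmorphXn. Qed.

Lemma nrm_sqr x : nrm x ^+ 2 = complex.Re (inner x x).
Proof. by rewrite inner_nrm. Qed.

Lemma inner_conj_nrm x y : nrm (inner x y) = nrm (inner y x).
Proof. by rewrite innerC nrm_conjc. Qed.

Lemma Re_innerC x y : complex.Re (inner x y) = complex.Re (inner y x).
Proof. by rewrite innerC; case: (inner y x). Qed.

Lemma inner_eq0C x y : inner x y = 0 -> inner y x = 0.
Proof. by move=> xy0; rewrite innerC xy0 conjc0. Qed.

Lemma nrm_sqrD x y :
  nrm (x + y) ^+ 2 = nrm x ^+ 2 + 2 * complex.Re (inner x y) + nrm y ^+ 2.
Proof.
rewrite !nrm_sqr innerDl !innerDr !raddfD/= (Re_innerC y x).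
ring.
Qed.

Lemma nrm_sqrB x y :
  nrm (x - y) ^+ 2 = nrm x ^+ 2 - 2 * complex.Re (inner x y) + nrm y ^+ 2.
Proof. by rewrite nrm_sqrD nrmN innerNr raddfN/= mulrN. Qed.

Lemma parallelogram x y :
  nrm (x + y) ^+ 2 + nrm (x - y) ^+ 2 = 2 * (nrm x ^+ 2 + nrm y ^+ 2).
Proof. by rewrite nrm_sqrD nrm_sqrB; ring. Qed.

Lemma Re_realM (a : R) z : complex.Re (a%:C * z) = a * complex.Re z.
Proof. by case: z => u v /=; rewrite mul0r subr0. Qed.

Lemma cauchy_schwarz x y : nrm (inner x y) <= nrm x * nrm y.
Proof.
have [->|y0] := eqVneq y 0; first by rewrite inner0r !nrm0 mulr0.
have ny : 0 < nrm y by rewrite lt_def nrm_ge0 nrm_eq0 y0.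
(* the component of x orthogonal to y has nonnegative squared norm *)
have := sqr_ge0 (nrm (x - (inner x y / (nrm y ^+ 2)%:C) *: y)).
set z := inner x y.
rewrite nrm_sqrB innerZr nrmZ -/z.
have -> : conjc (z / (nrm y ^+ 2)%:C) * z = (nrm z ^+ 2 / nrm y ^+ 2)%:C.
  rewrite -real_complexV conjcM conjc_real mulrAC [conjc _ * _]mulrC.
  by rewrite mulcJ -rmorphM.
rewrite -real_complexV nrmM nrm_real ger0_norm ?invr_ge0 ?sqr_ge0//=.
set a := nrm z; set b := nrm y; set c := nrm x.
have -> : c ^+ 2 - 2 * (a ^+ 2 / b ^+ 2) + (a / b ^+ 2 * b) ^+ 2 =
          c ^+ 2 - a ^+ 2 / b ^+ 2.
  by field; rewrite gt_eqF.
rewrite subr_ge0 ler_pdivrMr ?exprn_gt0// -exprMn ler_sqr ?nnegrE//.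
  exact: nrm_ge0.
by rewrite mulr_ge0// nrm_ge0.
Qed.

Lemma Re_inner_le x y : complex.Re (inner x y) <= nrm x * nrm y.
Proof. exact: le_trans (Re_le_nrm _) (cauchy_schwarz _ _). Qed.

Lemma inner_eq x y : (forall w, inner w x = inner w y) -> x = y.
Proof.
move=> xy; apply/eqP; rewrite -subr_eq0 -nrm_eq0 -sqrf_eq0 nrm_sqr.
by rewrite innerBr xy subrr.
Qed.

(** Completeness along an arbitrary proper filter on the index type: sequences
    need the filter of cofinite sets, compactness arguments an ultrafilter. *)
Lemma cauchy_filter_cvg (I : Type) (F : set_system I) (u : I -> H) :
  ProperFilter F ->
  (forall e : R, 0 < e -> exists2 A, F A &
     forall i j, A i -> A j -> nrm (u i - u j) <= e) ->
  exists l, forall e : R, 0 < e -> F [set i | nrm (u i - l) <= e].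
Proof.
move=> FF cau; pose G := u @ F.
have GF : ProperFilter G by exact: fmap_proper_filter.
have /cauchy_cvgP : cauchy G.
  apply/cauchy_ballP => e e0.
  have e0' : 0 < complex.Re e / 2.
    by move: e0; rewrite ltcE => /andP[_ e0]; rewrite divr_gt0.
  have eE : e = (complex.Re e)%:C.
    by rewrite RRe_real// gtr0_real.
  have [A FA Acau] := cau _ e0'.
  exists (u @` A, u @` A).
    split; rewrite /nbhs/= /G /fmap/=;
    by apply: filterS FA => i Ai; exists i.
  move=> [_ _] [/= [i Ai <-] [j Aj <-]].
  rewrite -ball_normE/= norm_nrm eE ltcR (le_lt_trans (Acau _ _ Ai Aj))//.
  by rewrite ltr_pdivrMr// ltr_pMr ?ltr1n// -ltcR -eE.
move=> Gl; exists (lim G) => e e0.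
have e0c : 0 < e%:C by rewrite ltcR.
have Gb : G (ball (lim G) e%:C) by apply: Gl; exact: nbhsx_ballx.
apply: (@filterS _ F _ _ _ _ Gb) => i.
by rewrite -ball_normE/= norm_nrm ltcR nrm_distC; exact: ltW.
Qed.

Lemma cauchy_seq_cvg (u : nat -> H) :
  (forall e : R, 0 < e -> exists N, forall i j, (N <= i)%N -> (N <= j)%N ->
     nrm (u i - u j) <= e) ->
  exists l, forall e : R, 0 < e -> exists N, forall i, (N <= i)%N ->
     nrm (u i - l) <= e.
Proof.
move=> cau; have [|l ul] := @cauchy_filter_cvg nat \oo u _.
- move=> e /cau[N Nu]; exists [set n | (N <= n)%N].
  by exists N.
  by move=> i j; exact: Nu.
- by exists l => e /ul[N _ Nu]; exists N => i Ni; exact: Nu.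
Qed.

End inner_product.

(** * Riesz representation and adjoints *)

Section linear_maps.
Context {R : realType} {H : hilbertType R}.
Implicit Types (x y w z : H) (T S A : H -> H).

Section linear.
Variable T : H -> H.
Hypothesis linT : linear T.

Lemma lin_mapD x y : T (x + y) = T x + T y.
Proof. by have := linT 1 x y; rewrite !scale1r. Qed.

Lemma lin_map0 : T 0 = 0.
Proof. by apply: (addrI (T 0)); rewrite -lin_mapD !addr0. Qed.

Lemma lin_mapZ (a : R[i]) x : T (a *: x) = a *: T x.
Proof. by have := linT a x 0; rewrite lin_map0 !addr0. Qed.

Lemma lin_mapN x : T (- x) = - T x.
Proof. by rewrite -scaleN1r lin_mapZ scaleN1r. Qed.

Lemma lin_mapB x y : T (x - y) = T x - T y.
Proof. by rewrite lin_mapD lin_mapN. Qed.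

Lemma lin_map_sum (I : Type) (r : seq I) (P : pred I) (F : I -> H) :
  T (\sum_(i <- r | P i) F i) = \sum_(i <- r | P i) T (F i).
Proof. exact: (big_morph T lin_mapD lin_map0). Qed.

End linear.

Lemma bounded_op_nrm T : bounded_op T ->
  exists2 M : R, 0 < M & forall x, nrm (T x) <= M * nrm x.
Proof.
move=> [_ [M TM]]; exists (Num.max M 1); first by rewrite lt_max ltr01 orbT.
move=> x; have := TM x; rewrite !norm_nrm -rmorphM/= lecR => /le_trans; apply.
by rewrite ler_wpM2r ?nrm_ge0// le_max lexx.
Qed.

Lemma bounded_opI T (M : R) :
  linear T -> (forall x, nrm (T x) <= M * nrm x) -> bounded_op T.
Proof.
by move=> lT TM; split=> //; exists M => x; rewrite !norm_nrm -rmorphM/= lecR.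
Qed.

Lemma invS_le_eps (e : R) : 0 < e ->
  exists N, forall i, (N <= i)%N -> i.+1%:R^-1 <= e.
Proof.
move=> e0; have [N _ Ne] := near_infty_natSinv_lt (PosNum e0).
by exists N => i /Ne /ltW.
Qed.

Lemma invS_gt0 n : 0 < (n.+1%:R^-1 : R).
Proof. by rewrite invr_gt0 ltr0n. Qed.

(** The functional x |-> |x|^2 - 2 Re (phi x) is bounded below on W, its
    minimising sequences are Cauchy by the parallelogram law, and the first
    variation vanishes at their limit. Taking the whole space for W gives the
    Riesz representation theorem; taking a span gives best approximations. The
    representing vector lies in the closure of W. *)
Lemma riesz_subspace (W : set H) (phi : H -> R[i]) (K : R) :
  W 0 -> (forall a x y, W x -> W y -> W (a *: x + y)) ->
  (forall a x y, W x -> W y -> phi (a *: x + y) = a * phi x + phi y) ->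
  (forall x, W x -> nrm (phi x) <= K * nrm x) ->
  exists z, (forall e : R, 0 < e -> exists2 w, W w & nrm (w - z) <= e) /\
            (forall x, W x -> phi x = inner x z).
Proof.
move=> W0 WP phiP phiK.
have WZ a x : W x -> W (a *: x) by move=> Wx; rewrite -[_ *: _]addr0; exact: WP.
have WD x y : W x -> W y -> W (x + y).
  by move=> Wx Wy; rewrite -[x]scale1r; exact: WP.
have phi0 : phi 0 = 0.
  have := phiP 1 0 0 W0 W0; rewrite scale1r addr0 mul1r => phi00.
  by apply: (addrI (phi 0)); rewrite addr0 -phi00.
have phiZ a x : W x -> phi (a *: x) = a * phi x.
  by move=> Wx; rewrite -[_ *: _]addr0 phiP// phi0 addr0.
have phiD x y : W x -> W y -> phi (x + y) = phi x + phi y.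
  by move=> Wx Wy; rewrite -{1}[x]scale1r phiP// mul1r.
pose F x := nrm x ^+ 2 - 2 * complex.Re (phi x).
have Flb x : W x -> - K ^+ 2 <= F x.
  move=> Wx; have := Re_le_nrm (phi x); have := phiK x Wx.
  rewrite /F => h1 h2; have := sqr_ge0 (nrm x - K); nra.
pose m := inf (F @` W).
have infF : has_inf (F @` W).
  split; first by exists (F 0); exists 0.
  by exists (- K ^+ 2) => _ [x Wx <-]; exact: Flb.
have Fm x : W x -> m <= F x.
  by move=> Wx; apply: (ge_inf infF.2); exists x.
have /choice[u uP] : forall n : nat, exists x, W x /\ F x <= m + n.+1%:R^-1.
  move=> n; have [_ [x Wx <-] /ltW Fx] := inf_adherent (invS_gt0 n) infF.
  by exists x.
have uW n : W (u n) by have [] := uP n.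
have uF n : F (u n) <= m + n.+1%:R^-1 by have [] := uP n.
have ucau i j : nrm (u i - u j) ^+ 2 <= 2 * (i.+1%:R^-1 + j.+1%:R^-1).
  have := parallelogram (u i) (u j).
  have := Fm (2^-1%:C *: (u i + u j)) (WZ _ _ (WD _ _ (uW i) (uW j))).
  rewrite /F nrmZ phiZ; last exact: WD.
  rewrite phiD// Re_realM raddfD/= nrm_real ger0_norm ?invr_ge0// exprMn.
  have := uF i; have := uF j; rewrite /F.
  by move: (i.+1%:R^-1) (j.+1%:R^-1) => a b; lra.
have [|z uz] := @cauchy_seq_cvg _ _ u.
  move=> e e0; have e24 : 0 < e ^+ 2 / 4 by rewrite divr_gt0// exprn_gt0.
  have [N Ne] := invS_le_eps e24; exists N => i j /Ne Ni /Ne Nj.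
  apply: le_of_sqr (ltW e0) _; rewrite (le_trans (ucau i j))//.
  by move: Ni Nj; move: (i.+1%:R^-1) (j.+1%:R^-1) => a b; lra.
exists z; split.
  by move=> e /uz[N Nu]; exists (u N); [exact: uW|exact: Nu].
have var n w : W w ->
    (complex.Re (inner (u n) w) - complex.Re (phi w)) ^+ 2
      <= n.+1%:R^-1 * (nrm w ^+ 2 + 1).
  move=> Ww; set D := _ - _; set N := _ + 1.
  have N0 : 0 < N by rewrite ltr_wpDl// sqr_ge0.
  have key (t : R) : - n.+1%:R^-1 <= 2 * t * D + t ^+ 2 * nrm w ^+ 2.
    have := Fm (u n + t%:C *: w) (WD _ _ (uW n) (WZ _ _ Ww)).
    rewrite /F nrm_sqrD phiD//; last exact: WZ.
    rewrite phiZ// ReD innerZr conjc_real !Re_realM nrmZ nrm_real exprMn.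
    rewrite real_normK ?num_real//.
    by have := uF n; rewrite /F /D; move: (n.+1%:R^-1) => a; lra.
  have := key (- D / N).
  have -> : 2 * (- D / N) * D + (- D / N) ^+ 2 * nrm w ^+ 2 =
      - (D ^+ 2 / N) - D ^+ 2 / N ^+ 2.
    have -> : nrm w ^+ 2 = N - 1 by rewrite /N addrK.
    by field; rewrite gt_eqF.
  move=> h; rewrite -ler_pdivrMr//.
  rewrite -lerN2 (le_trans h)// lerBlDr lerDl divr_ge0 ?sqr_ge0//.
have ReW w : W w -> complex.Re (phi w) = complex.Re (inner w z).
  move=> Ww; set N := nrm w ^+ 2 + 1.
  have N0 : 0 < N by rewrite ltr_wpDl// sqr_ge0.
  have N1 : nrm w <= N.
    by rewrite /N; have := sqr_ge0 (nrm w - 1); have := nrm_ge0 w; nra.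
  apply/eqP; rewrite eq_sym -subr_eq0 -normr_le0; apply: eq0_le_eps => e e0.
  have d0 : 0 < (e / 2) ^+ 2 / N by rewrite divr_gt0// exprn_gt0// divr_gt0.
  have d1 : 0 < e / 2 / N by rewrite divr_gt0// divr_gt0.
  have [N1' h1] := invS_le_eps d0; have [N2 h2] := uz _ d1.
  pose n := maxn N1' N2.
  have {}h1 := h1 n (leq_maxl _ _); have {}h2 := h2 n (leq_maxr _ _).
  have -> : complex.Re (inner w z) - complex.Re (phi w) =
    (complex.Re (inner (u n) w) - complex.Re (phi w))
    + complex.Re (inner w (z - u n)).
    by rewrite innerBr raddfB/= (Re_innerC (u n)); ring.
  rewrite (le_trans (ler_normD _ _))// [leRHS](splitr e) lerD//.
    apply: le_of_sqr; first by rewrite divr_ge0// ltW.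
    rewrite real_normK ?num_real//.
    rewrite (le_trans (var n w Ww))//.
    by rewrite -ler_pdivlMr.
  have h v : `|complex.Re (inner w v)| <= nrm w * nrm v.
    rewrite ler_norml Re_inner_le andbT lerNl -raddfN/= -innerNr.
    by rewrite (le_trans (Re_inner_le _ _))// nrmN.
  rewrite (le_trans (h _))// nrm_distC.
  rewrite (le_trans (ler_pM (nrm_ge0 _) (nrm_ge0 _) N1 h2))//.
  by rewrite mulrCA divff ?mulr1// gt_eqF.
move=> x Wx; have := ReW _ (WZ 'i x Wx); have := ReW _ Wx.
rewrite phiZ// innerZl; case: (phi x) (inner x z) => a b [c d]/=.
by rewrite !mul0r !mul1r !sub0r => -> /oppr_inj ->.
Qed.

Lemma adjoint_ex T : bounded_op T ->
  exists S, forall x y, inner (T x) y = inner x (S y).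
Proof.
move=> bT; have [M M0 TM] := bounded_op_nrm bT; case: bT => lT _.
suff /choice[S SP] : forall y, exists z, forall x, inner (T x) y = inner x z.
  by exists S => x y; exact: SP.
move=> y; have [//|//|||z [_ zP]] :=
    @riesz_subspace setT (fun x => inner (T x) y) (M * nrm y).
- by move=> a x w _ _; rewrite lT innerDl innerZl.
- move=> x _; rewrite (le_trans (cauchy_schwarz _ _))//.
  by rewrite mulrAC ler_wpM2r ?nrm_ge0.
- by exists z => x; exact: zP.
Qed.

Lemma adjointE T x y : bounded_op T -> inner (T x) y = inner x (adjoint T y).
Proof.
by move=> /adjoint_ex[S SP]; exact: (@xgetPex _ 0 (fun S => forall x y,
  inner (T x) y = inner x (S y)) (ex_intro _ S SP) x y).
Qed.

Lemma adjointEr T x y : bounded_op T -> inner y (T x) = inner (adjoint T y) x.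
Proof. by move=> bT; rewrite innerC adjointE// -innerC. Qed.

Lemma adjoint_le T (M : R) : bounded_op T ->
  (forall x, nrm (T x) <= M * nrm x) ->
  forall x, nrm (adjoint T x) <= M * nrm x.
Proof.
move=> bT TM x; set y := adjoint T x.
have [->|y0] := eqVneq y 0.
  by rewrite nrm0 (le_trans (nrm_ge0 (T x))).
have ny : 0 < nrm y by rewrite lt_def nrm_ge0 nrm_eq0 y0.
rewrite -(ler_pM2r ny) -expr2 nrm_sqr {2}/y -adjointE//.
rewrite (le_trans (Re_inner_le _ _))// mulrAC.
by rewrite ler_wpM2r ?nrm_ge0.
Qed.

Lemma adjoint_bounded T : bounded_op T -> bounded_op (adjoint T).
Proof.
move=> bT; have [M M0 TM] := bounded_op_nrm bT.
apply: (@bounded_opI _ M); last exact: adjoint_le.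
move=> a x y; apply: inner_eq => w.
rewrite -adjointE// !innerDr !innerZr.
by rewrite -!adjointE.
Qed.

End linear_maps.
(** * Sums over arbitrary index sets *)

Section esum_complements.
Context {R : realType} {I J : choiceType}.
Local Open Scope ereal_scope.
Implicit Types (D : set I) (a : I -> \bar R).

Lemma esum_le_seq D a c :
  (forall s, uniq s -> (forall i, i \in s -> D i) ->
     \sum_(i <- s) a i <= c) ->
  \esum_(i in D) a i <= c.
Proof.
move=> h; apply: ge_ereal_sup => _ [X [finX XD] <-].
rewrite fsbig_finite//; apply: h; first exact: fset_uniq.
by move=> i; rewrite in_fset_set// => /set_mem /XD.
Qed.

Lemma seq_le_esum D a s : uniq s -> (forall i, i \in s -> D i) ->
  \sum_(i <- s) a i <= \esum_(i in D) a i.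
Proof.
move=> us sD; apply: esum_ge; exists [set` s]; last by rewrite fsbig_seq.
by split=> //; exact: finite_seq.
Qed.

Lemma esumZl D a (c : R) : (0 <= c)%R -> (forall i, D i -> 0 <= a i) ->
  \esum_(i in D) (c%:E * a i) = c%:E * \esum_(i in D) a i.
Proof.
move=> c0 a0.
have half (c' : R) b : (0 <= c')%R -> (forall i, D i -> 0 <= b i) ->
    \esum_(i in D) (c'%:E * b i) <= c'%:E * \esum_(i in D) b i.
  move=> c'0 b0; apply: esum_le_seq => s us sD.
  rewrite big_seq -ge0_sume_distrr; last by move=> i /sD /b0.
  by rewrite -big_seq lee_wpmul2l ?lee_fin// seq_le_esum.
have [->|cN0] := eqVneq c 0%R.
  by rewrite mul0e esum1// => i _; rewrite mul0e.
apply/eqP; rewrite eq_le half//=.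
rewrite (@eq_esum _ _ _ a (fun i => (c^-1)%:E * (c%:E * a i))); last first.
  by move=> i _; rewrite muleA -EFinM mulVf// mul1e.
rewrite (@le_trans _ _ (c%:E * ((c^-1)%:E * \esum_(i in D) (c%:E * a i))))//.
  rewrite lee_wpmul2l ?lee_fin// half ?invr_ge0// => i Di.
  by rewrite mule_ge0// a0.
by rewrite muleA -EFinM mulfV// mul1e.
Qed.

End esum_complements.

Lemma esum_swap (R : realType) (I J : choiceType) (D : set I) (E : set J)
    (a : I -> J -> \bar R) : (forall i j, D i -> E j -> 0 <= a i j)%E ->
  (\esum_(i in D) \esum_(j in E) a i j =
   \esum_(j in E) \esum_(i in D) a i j)%E.
Proof.
have half (I' J' : choiceType) (D' : set I') (E' : set J') b :
    (forall i j, D' i -> E' j -> 0 <= b i j)%E ->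
    (\esum_(i in D') \esum_(j in E') b i j <=
     \esum_(j in E') \esum_(i in D') b i j :> \bar R)%E.
  move=> b0; apply: esum_le_seq => s us sD.
  rewrite big_seq -esum_sum; last by move=> j i Ej /sD Di; exact: b0.
  by apply: le_esum => j Ej; rewrite -big_seq seq_le_esum.
by move=> a0; apply/eqP; rewrite eq_le !half// => i j Di Ej; exact: a0.
Qed.

(** * Orthonormal families: Bessel and Parseval *)

Section orthonormal.
Context {R : realType} {H : hilbertType R}.
Implicit Types (x y w z : H) (E F : set H).

Definition orthonormal_on (I : eqType) (D : set I) (u : I -> H) :=
  forall i j, D i -> D j -> inner (u i) (u j) = (i == j)%:R.

Lemma orthonormal_nrm (I : eqType) (D : set I) (u : I -> H) i :
  orthonormal_on D u -> D i -> nrm (u i) = 1.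
Proof.
move=> ou Di; apply/eqP.
by rewrite -(@eqrXn2 _ 2) ?nrm_ge0// expr1n nrm_sqr ou// eqxx.
Qed.

Section finite_combination.
Variables (I : eqType) (D : set I) (u : I -> H) (s : seq I).
Hypotheses (ou : orthonormal_on D u) (us : uniq s)
  (sD : forall i, i \in s -> D i).

Lemma inner_comb (c : I -> R[i]) j : j \in s ->
  inner (\sum_(i <- s) c i *: u i) (u j) = c j.
Proof.
move=> js; have Dj := sD js.
rewrite inner_suml (bigD1_seq j)//= innerZl ou ?eqxx ?mulr1//.
rewrite big_seq_cond big1 ?addr0// => i /andP[si ij].
by rewrite innerZl ou ?(negbTE ij) ?mulr0//; exact: sD.
Qed.

Lemma nrm_comb (c : I -> R[i]) :
  nrm (\sum_(i <- s) c i *: u i) ^+ 2 = \sum_(i <- s) nrm (c i) ^+ 2.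
Proof.
rewrite nrm_sqr inner_sumr Re_sum big_seq [RHS]big_seq.
apply: eq_bigr => i si; rewrite innerZr inner_comb// mulrC mulcJ//.
Qed.

(** Pythagoras, for the orthogonal projection on a finite span. *)
Lemma nrm_sqr_proj x :
  nrm x ^+ 2 = nrm (x - \sum_(i <- s) inner x (u i) *: u i) ^+ 2 +
               \sum_(i <- s) nrm (inner x (u i)) ^+ 2.
Proof.
rewrite nrm_sqrB nrm_comb inner_sumr Re_sum.
rewrite [in X in _ - 2 * X](eq_bigr (fun i => nrm (inner x (u i)) ^+ 2)).
  by ring.
by move=> i _; rewrite innerZr mulrC mulcJ.
Qed.

Lemma bessel_seq x : \sum_(i <- s) nrm (inner x (u i)) ^+ 2 <= nrm x ^+ 2.
Proof. by rewrite [leRHS]nrm_sqr_proj lerDr sqr_ge0. Qed.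

End finite_combination.

Lemma bessel (I : choiceType) (D : set I) (u : I -> H) x :
  orthonormal_on D u ->
  (\esum_(i in D) (nrm (inner x (u i)) ^+ 2)%:E <= (nrm x ^+ 2)%:E)%E.
Proof.
move=> ou; apply: esum_le_seq => s us sD.
by rewrite sumEFin lee_fin (bessel_seq ou).
Qed.

Lemma basis_orthonormal E : orthonormal_basis E -> orthonormal_on E id.
Proof.
move=> [E1 E0 _] e e' Ee Ee'; have [<-|ee'] := eqVneq e e'; first by rewrite E1.
by rewrite E0.
Qed.

(** The vectors whose orthocomplement contains that of some finite part of E
    form a subspace; the functional w |-> <w, x> is represented on it by a
    vector z of its closure, and x - z is orthogonal to all of E. *)
Lemma expansion_approx E x (e : R) : orthonormal_basis E -> 0 < e ->
  exists s, [/\ uniq s, forall v, v \in s -> E v &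
    nrm (x - \sum_(v <- s) inner x v *: v) <= e].
Proof.
move=> bE e0; have oE := basis_orthonormal bE.
pose W := [set w | exists2 s : seq H, (forall v, v \in s -> E v) &
  forall y, (forall v, v \in s -> inner y v = 0) -> inner w y = 0].
have [||||z [zW xz]] := @riesz_subspace _ _ W (fun w => inner w x) (nrm x).
- by exists [::] => // y _; rewrite inner0l.
- move=> a w w' [s sE sP] [s' s'E s'P]; exists (s ++ s').
    by move=> v; rewrite mem_cat => /orP[/sE|/s'E].
  move=> y yP; rewrite innerDl innerZl sP ?s'P ?mulr0 ?addr0// => v vs.
    by apply: yP; rewrite mem_cat vs orbT.
  by apply: yP; rewrite mem_cat vs.
- by move=> a w w' _ _; rewrite innerDl innerZl.
- by move=> w _; rewrite mulrC cauchy_schwarz.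
have {xz}xz : x = z.
  apply/eqP; rewrite -subr_eq0; apply/eqP; case: bE => _ _; apply => v Ev.
  apply: inner_eq0C; rewrite innerBr xz ?subrr//; exists [:: v].
    by move=> w; rewrite inE => /eqP ->.
  by move=> y yv; apply: inner_eq0C; apply: yv; rewrite inE.
rewrite -{}xz in zW; have [w [s sE sP] wx] := zW _ e0.
exists (undup s); split; first exact: undup_uniq.
  by move=> v; rewrite mem_undup => /sE.
set p := \sum_(v <- _) _.
have sE' v : v \in undup s -> E v by rewrite mem_undup => /sE.
have pv v : v \in s -> inner (x - p) v = 0.
  move=> vs; rewrite innerBl -[v in X in _ - X]/(id v).
  by rewrite (inner_comb oE (undup_uniq s) sE') ?mem_undup// subrr.
have wxp : inner w (x - p) = 0 by exact: sP.
have pxp : inner p (x - p) = 0.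
  rewrite inner_suml big_seq big1// => v; rewrite mem_undup => vs.
  by rewrite innerZl (inner_eq0C (pv _ vs)) mulr0.
apply: le_trans wx; apply: le_of_sqr; first exact: nrm_ge0.
have -> : w - x = (w - p) - (x - p) by rewrite opprB addrA subrK.
by rewrite (nrm_sqrB (w - p)) innerBl wxp pxp subrr mulr0 subr0 lerDr sqr_ge0.
Qed.

Lemma parseval E x : orthonormal_basis E ->
  (\esum_(v in E) (nrm (inner x v) ^+ 2)%:E = (nrm x ^+ 2)%:E)%E.
Proof.
move=> bE; apply/eqP; rewrite eq_le; have oE := basis_orthonormal bE.
rewrite (bessel x oE)/=; apply/lee_addgt0Pr => e e0.
have se0 : 0 < Num.sqrt e by rewrite sqrtr_gt0.
have [s [us sE sx]] := expansion_approx x bE se0.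
rewrite (nrm_sqr_proj oE us sE) EFinD addeC leeD//.
  by rewrite -sumEFin seq_le_esum.
rewrite lee_fin -(sqr_sqrtr (ltW e0)) ler_sqr// nnegrE ?nrm_ge0//.
Qed.

Lemma inner_le_esum E x y : orthonormal_basis E ->
  ((nrm (inner x y))%:E <=
   \esum_(v in E) (nrm (inner x v) * nrm (inner v y))%:E)%E.
Proof.
move=> bE; apply/lee_addgt0Pr => e e0.
have ny0 : 0 < nrm y + 1 by rewrite ltr_wpDl ?nrm_ge0.
have ey0 : 0 < e / (nrm y + 1) by rewrite divr_gt0.
have [s [us sE sx]] := expansion_approx x bE ey0.
set p := \sum_(v <- _) _ in sx.
apply: (@le_trans _ _
  ((\sum_(v <- s) nrm (inner x v) * nrm (inner v y)) + e)%:E).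
  have -> : inner x y = inner p y + inner (x - p) y.
    by rewrite -innerDl addrC subrK.
  rewrite lee_fin.
  rewrite (le_trans (ler_nrmD _ _))// lerD//.
    rewrite inner_suml (le_trans (ler_nrm_sum _ _ _))//.
    by apply: ler_sum => v _; rewrite innerZl nrmM.
  rewrite (le_trans (cauchy_schwarz _ _))//.
  rewrite (le_trans (ler_wpM2r (nrm_ge0 _) sx))// -mulrA ler_piMr ?ltW//.
  by rewrite mulrC ltr_pdivrMr// mul1r ltrDl.
by rewrite EFinD leeD// -sumEFin seq_le_esum.
Qed.

End orthonormal.

(** * Positive operators *)

Section positive_operators.
Context {R : realType} {H : hilbertType R}.
Implicit Types (x y w z : H) (A B D T : H -> H).

Definition self_adjoint A := forall x y, inner (A x) y = inner x (A y).

Lemma Im_le_nrm (z : R[i]) : `|complex.Im z| <= nrm z.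
Proof.
apply: le_of_sqr; first exact: nrm_ge0.
by rewrite nrm_sqrE real_normK ?num_real// lerDr sqr_ge0.
Qed.

Lemma positive_Re A x : positive_op A ->
  inner (A x) x = (complex.Re (inner (A x) x))%:C.
Proof. by move=> [_ /(_ x) /ger0_real /RRe_real ->]. Qed.

Lemma positive_Re_ge0 A x : positive_op A -> 0 <= complex.Re (inner (A x) x).
Proof. by move=> pA; rewrite -ler0c -positive_Re//; case: pA. Qed.

(** Polarisation: a sesquilinear form that is real on the diagonal is
    hermitian. *)
Lemma positive_self_adjoint A : positive_op A -> self_adjoint A.
Proof.
move=> pA x y; have lA := pA.1.1.
have diag v : inner (A v) v - inner v (A v) = 0.
  by rewrite (innerC v) positive_Re// conjc_real subrr.
apply/eqP; rewrite -subr_eq0; apply/eqP.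
have := diag (x + y); have := diag (x + 'i *: y).
rewrite !(lin_mapD lA) !(lin_mapZ lA) !innerDl !innerDr !innerZl !innerZr.
have := diag x; have := diag y.
move: (inner (A x) x) (inner x (A x)) (inner (A y) y) (inner y (A y)).
move: (inner (A x) y) (inner x (A y)) (inner (A y) x) (inner y (A x)).
move=> a b c d a' b' c' d' /eqP + /eqP; rewrite !subr_eq0 => /eqP-> /eqP->.
move: a b c d b' d' => [a1 a2] [b1 b2] [c1 c2] [d1 d2] [e1 e2] [f1 f2].
move=> /eqP; rewrite eq_complex/= => /andP[/eqP h1 /eqP h2].
move=> /eqP; rewrite eq_complex/= => /andP[/eqP h3 /eqP h4].
by apply/eqP; rewrite eq_complex/=; apply/andP; split; apply/eqP; lra.
Qed.

(** The vector x - t D x, tested against the positive form of D at t = 1/K. *)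
Lemma nrm_sqr_le_form D (K : R) x : linear D -> self_adjoint D ->
  0 < K -> (forall v, nrm (D v) <= K * nrm v) ->
  (forall k : R, let v := x - k%:C *: D x in
    0 <= complex.Re (inner (D v) v)) ->
  nrm (D x) ^+ 2 <= K * complex.Re (inner (D x) x).
Proof.
move=> lD sD K0 DK pD.
have /= := pD K^-1.
rewrite (lin_mapB lD) (lin_mapZ lD) !innerBl !innerBr !innerZl !innerZr.
rewrite conjc_real.
rewrite (sD (D x) x) !ReB !Re_realM -!nrm_sqr.
have : complex.Re (inner (D (D x)) (D x)) <= K * nrm (D x) ^+ 2.
  rewrite (le_trans (Re_inner_le _ _))// expr2 mulrA ler_wpM2r ?nrm_ge0//.
set a := complex.Re _; set b := _ ^+ 2; set c := complex.Re _ => h1 h2.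
have h3 : K^-1 * (K^-1 * a) <= K^-1 * b.
  by rewrite ler_pM2l ?invr_gt0// mulrC ler_pdivrMr// mulrC.
have : 0 <= c - K^-1 * b by lra.
by rewrite subr_ge0 mulrC ler_pdivrMr// mulrC.
Qed.

(** * Polynomials of a positive operator *)

Definition cpoly (q : {poly R[i]}) A x := \sum_(k < size q) q`_k *: iter k A x.

Section polynomials.
Variable A : H -> H.
Hypothesis lA : linear A.
Implicit Types (p q : {poly R[i]}) (r : {poly R}) (c : R[i]).

Lemma linear_iter k : linear (iter k A).
Proof. by elim: k => [//|k IH] a x y; rewrite !iterS IH lA. Qed.

Lemma cpoly_widen n q x : (size q <= n)%N ->
  cpoly q A x = \sum_(k < n) q`_k *: iter k A x.
Proof.
move=> qn; rewrite /cpoly (big_ord_widen n (fun k => q`_k *: iter k A x))//.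
rewrite big_mkcond/=; apply: eq_bigr => i _; case: ltnP => // /(nth_default 0).
by move=> ->; rewrite scale0r.
Qed.

Lemma cpoly_linear q : linear (cpoly q A).
Proof.
move=> a x y; rewrite /cpoly scaler_sumr -big_split/=; apply: eq_bigr => i _.
by rewrite linear_iter scalerDr !scalerA mulrC.
Qed.

Lemma cpolyD p q x : cpoly (p + q) A x = cpoly p A x + cpoly q A x.
Proof.
rewrite !(@cpoly_widen (maxn (size p) (size q))) ?leq_maxl ?leq_maxr//.
  by rewrite -big_split/=; apply: eq_bigr => i _; rewrite coefD scalerDl.
exact: size_polyD.
Qed.

Lemma cpolyC c x : cpoly c%:P A x = c *: x.
Proof.
by rewrite (@cpoly_widen 1) ?size_polyC ?leq_b1// big_ord1 coefC.
Qed.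

Lemma cpolyMX p x : cpoly (p * 'X) A x = cpoly p A (A x).
Proof.
rewrite (@cpoly_widen (size p).+1); last first.
  by rewrite (leq_trans (size_polyMleq _ _))// size_polyX addn2.
rewrite big_ord_recl coefMX/= scale0r add0r; apply: eq_bigr => i _.
by rewrite coefMX/= -iterSr.
Qed.

Lemma cpoly_comm p x : cpoly p A (A x) = A (cpoly p A x).
Proof.
rewrite /cpoly (lin_map_sum lA); apply: eq_bigr => i _.
by rewrite (lin_mapZ lA) -iterS iterSr.
Qed.

Lemma cpolyM p q x : cpoly (p * q) A x = cpoly p A (cpoly q A x).
Proof.
elim/poly_ind: p x => [|p c IH] x.
  by rewrite mul0r /cpoly size_poly0 !big_ord0.
rewrite mulrDl !cpolyD cpolyMX mulrAC cpolyMX -cpoly_comm IH; congr (_ + _).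
rewrite cpolyC mul_polyC /cpoly scaler_sumr.
rewrite -/(cpoly (c *: q) A x) (@cpoly_widen (size q)) ?size_scale_leq//.
by apply: eq_bigr => i _; rewrite coefZ scalerA.
Qed.

Lemma cpolyX x : cpoly 'X A x = A x.
Proof. by rewrite -['X]mul1r cpolyMX -polyC1 cpolyC scale1r. Qed.

Lemma cpolyB p q x : cpoly (p - q) A x = cpoly p A x - cpoly q A x.
Proof.
by rewrite cpolyD -[- q]mulN1r -polyC1 -polyCN cpolyM cpolyC scaleN1r.
Qed.

Lemma cpolyXsubC c x : cpoly ('X - c%:P) A x = A x - c *: x.
Proof. by rewrite cpolyB cpolyX cpolyC. Qed.

Lemma iter_le (M : R) k x : (forall v, nrm (A v) <= M * nrm v) -> 0 <= M ->
  nrm (iter k A x) <= M ^+ k * nrm x.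
Proof.
move=> AM M0; elim: k => [|k IH]; first by rewrite expr0 mul1r.
by rewrite iterS (le_trans (AM _))// exprS -mulrA ler_wpM2l.
Qed.

Lemma cpoly_bound (M : R) q : (forall v, nrm (A v) <= M * nrm v) -> 0 <= M ->
  exists2 K : R, 0 < K & forall x, nrm (cpoly q A x) <= K * nrm x.
Proof.
move=> AM M0; exists (1 + \sum_(k < size q) nrm q`_k * M ^+ k).
  rewrite ltr_wpDr// sumr_ge0// => i _.
  by rewrite mulr_ge0 ?nrm_ge0// exprn_ge0.
move=> x; rewrite mulrDl mul1r.
rewrite (@le_trans _ _ (\sum_(k < size q) nrm q`_k * M ^+ k * nrm x))//.
  rewrite (le_trans (ler_nrm_sum _ _ _))// ler_sum// => i _.
  by rewrite nrmZ -mulrA ler_wpM2l ?nrm_ge0// iter_le.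
by rewrite -mulr_suml lerDr nrm_ge0.
Qed.

Lemma cpoly_eigen q x c : A x = c *: x -> cpoly q A x = q.[c] *: x.
Proof.
move=> Ax; rewrite horner_coef scaler_suml; apply: eq_bigr => i _.
suff -> : iter i A x = c ^+ i *: x by rewrite scalerA.
elim: {i}(nat_of_ord i) => [|k IH]; first by rewrite expr0 scale1r.
by rewrite iterS IH (lin_mapZ lA) Ax scalerA exprSr.
Qed.

Lemma op_polyE r x : op_poly r A x = cpoly (map_poly (real_complex R) r) A x.
Proof.
rewrite /op_poly /cpoly size_map_poly.
by apply: eq_bigr => i _; rewrite coef_map.
Qed.

Lemma op_poly_self_adjoint r : self_adjoint A -> self_adjoint (op_poly r A).
Proof.
move=> sA x y; rewrite /op_poly inner_suml inner_sumr; apply: eq_bigr => i _.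
rewrite innerZl innerZr conjc_real; congr (_ * _).
elim: {i}(nat_of_ord i) x y => [//|k IH] x y.
by rewrite iterS sA IH iterSr.
Qed.

End polynomials.

(** Approximate point spectrum: if A - c is not bounded below, then c is a limit
    of values of the numerical range, which lies in [0, M]. *)
Lemma not_bounded_below A (M : R) (c : R[i]) : positive_op A ->
  (forall v, nrm (A v) <= M * nrm v) ->
  ~ (exists2 d : R, 0 < d & forall x, d * nrm x <= nrm (A x - c *: x)) ->
  exists2 t : R, 0 <= t <= M & c = t%:C.
Proof.
move=> pA AM nbb.
have approx (d : R) : 0 < d ->
    exists2 t, 0 <= t <= M & nrm (t%:C - c) <= d.
  move=> d0; have /existsNP[x /negP] :
      ~ forall x, d * nrm x <= nrm (A x - c *: x).
    by move=> h; apply: nbb; exists d.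
  rewrite -ltNge => xd.
  have x0 : 0 < nrm x.
    rewrite lt_def nrm_ge0 andbT; apply/eqP => x0; move: xd.
    by rewrite x0 mulr0 ltNge nrm_ge0.
  have x20 : 0 < nrm x ^+ 2 by rewrite exprn_gt0.
  exists (complex.Re (inner (A x) x) / nrm x ^+ 2).
    rewrite divr_ge0 ?positive_Re_ge0 ?sqr_ge0//= ler_pdivrMr//.
    rewrite (le_trans (Re_inner_le _ _))// expr2 mulrA ler_wpM2r ?nrm_ge0//.
  rewrite -(ler_pM2r x20) -[X in _ * X <= _]ger0_norm ?sqr_ge0//.
  rewrite -nrm_real -nrmM mulrBl -[X in X - _]rmorphM/= divfK ?gt_eqF//.
  rewrite -positive_Re// -inner_nrm -innerZl -innerBl.
  rewrite (le_trans (cauchy_schwarz _ _))// expr2 mulrA ler_wpM2r ?nrm_ge0//.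
  exact: ltW.
have Imc : complex.Im c = 0.
  apply/eqP; rewrite -normr_le0; apply: eq0_le_eps => d /approx[t _].
  apply: le_trans; rewrite -normrN; have := Im_le_nrm (t%:C - c).
  by case: c {nbb approx} => u v /=; rewrite add0r.
have Rec (d : R) : 0 < d -> exists2 t, 0 <= t <= M & `|t - complex.Re c| <= d.
  move=> /approx[t tM tc]; exists t => //; move: tc.
  by case: c Imc {nbb approx} => u v /= ->; rewrite -nrm_real rmorphB.
exists (complex.Re c); last by case: c Imc {nbb approx Rec} => u v /= ->.
apply/andP; split; apply/ler_addgt0Pr => d /Rec[t /andP[t0 tM]];
  by rewrite ler_norml => /andP[]; lra.
Qed.

(** With m the infimum of the numerical range of q(A), the operator q(A) - m is
    positive and not bounded below, so one of the factors A - z of its complex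
    factorisation is not bounded below either. Then z is real, lies in [0, M],
    and m = q(z) >= 0. *)
Theorem op_poly_ge0 A (M : R) (q : {poly R}) x : positive_op A ->
  (forall v, nrm (A v) <= M * nrm v) -> 0 <= M ->
  (forall t, 0 <= t <= M -> 0 <= q.[t]) ->
  0 <= complex.Re (inner (op_poly q A x) x).
Proof.
move=> pA AM M0 q0; have lA := pA.1.1; have sA := positive_self_adjoint pA.
rewrite leNgt; apply/negP => xneg.
pose toC := map_poly (real_complex R).
pose num y := complex.Re (inner (op_poly q A y) y).
have [K K0 BK] := cpoly_bound (toC q) AM M0.
pose S := [set num y | y in [set y | nrm y = 1]].
have lB : linear (op_poly q A).
  by move=> a u v; rewrite !op_polyE// cpoly_linear.
have x0 : 0 < nrm x.
  rewrite lt_def nrm_ge0 nrm_eq0 andbT; apply/eqP => x0; move: xneg.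
  by rewrite x0 inner0r ltxx.
have numZ (a : R) y : num (a%:C *: y) = a ^+ 2 * num y.
  rewrite /num (lin_mapZ lB) innerZl innerZr conjc_real !Re_realM.
  by rewrite mulrA expr2.
have unit y : 0 < nrm y -> nrm ((nrm y)^-1%:C *: y) = 1.
  by move=> y0; rewrite nrmZ nrm_real gtr0_norm ?invr_gt0// mulVf ?gt_eqF.
have infS : has_inf S.
  split.
    exists (num ((nrm x)^-1%:C *: x)); exists ((nrm x)^-1%:C *: x) => //=.
    by rewrite unit.
  exists (- K) => _ [y /= y1 <-]; rewrite lerNl /num.
  rewrite -[- complex.Re _]mulN1r -[-1 * _]Re_realM rmorphN1 mulN1r -innerNl.
  rewrite (le_trans (Re_inner_le _ _))// nrmN op_polyE// y1 mulr1.
  by rewrite (le_trans (BK _))// y1 mulr1.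
pose m := inf S.
have m_lb y : m * nrm y ^+ 2 <= num y.
  have [y0|] := ltP 0 (nrm y); last first.
    rewrite le_eqVlt ltNge nrm_ge0 orbF nrm_eq0 => /eqP ->.
    by rewrite nrm0 expr0n mulr0 /num inner0r.
  have : m <= num ((nrm y)^-1%:C *: y).
    by apply: (ge_inf infS.2); exists ((nrm y)^-1%:C *: y) => //=; rewrite unit.
  by rewrite numZ exprVn mulrC ler_pdivlMr ?exprn_gt0.
have m_neg : m < 0.
  have := le_lt_trans (m_lb x) xneg.
  by rewrite pmulr_llt0// exprn_gt0.
pose D := op_poly (q - m%:P) A.
have DE y : D y = op_poly q A y - m%:C *: y.
  by rewrite /D !op_polyE// rmorphB/= cpolyB// map_polyC/= cpolyC.
have lD : linear D by move=> a u v; rewrite /D !op_polyE// cpoly_linear.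
have sD : self_adjoint D by exact: op_poly_self_adjoint.
have [L L0 DL] := cpoly_bound (toC (q - m%:P)) AM M0.
have {}DL v : nrm (D v) <= L * nrm v by rewrite /D op_polyE.
have numD v : complex.Re (inner (D v) v) = num v - m * nrm v ^+ 2.
  by rewrite DE innerBl innerZl ReB Re_realM -nrm_sqr.
have D0 v : 0 <= complex.Re (inner (D v) v) by rewrite numD subr_ge0.
have nbbD : ~ exists2 d : R, 0 < d & forall v, d * nrm v <= nrm (D v).
  move=> [d d0 Dd]; have e0 : 0 < d ^+ 2 / L by rewrite divr_gt0// exprn_gt0.
  have [_ [v /= v1 <-]] := inf_adherent e0 infS.
  rewrite -/m ltNge => /negP; apply; rewrite -lerBrDl ler_pdivrMr//.
  have := nrm_sqr_le_form (x := v) lD sD L0 DL (fun k => D0 _).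
  rewrite numD v1 expr1n mulr1 mulrC; apply: le_trans.
  rewrite ler_sqr ?nnegrE ?nrm_ge0 ?(ltW d0)// (le_trans _ (Dd v))//.
  by rewrite v1 mulr1.
have qm0 : q - m%:P != 0.
  apply/eqP => /(congr1 (fun p => p.[0])); rewrite !hornerE.
  by have := q0 0; rewrite lexx M0 => /(_ isT); lra.
have [rs rsE] := closed_field_poly_normal (toC (q - m%:P)).
have c0 : lead_coef (toC (q - m%:P)) != 0.
  by rewrite lead_coef_map fmorph_eq0 lead_coef_eq0.
have [z zrs znbb] : exists2 z, z \in rs & ~ exists2 d : R, 0 < d &
    forall v, d * nrm v <= nrm (A v - z *: v).
  apply: contrapT => allbb; apply: nbbD.
  have {}allbb (z : R[i]) : z \in rs -> exists2 d : R, 0 < d &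
      forall v, d * nrm v <= nrm (A v - z *: v).
    by move=> zrs; apply: contrapT => h; apply: allbb; exists z.
  have [d d0 dP] : exists2 d : R, 0 < d & forall v : H,
      d * nrm v <= nrm (cpoly (\prod_(c <- rs) ('X - c%:P)) A v).
    elim: (rs) allbb => [|z s IH] bb.
      by exists 1 => // v; rewrite big_nil -polyC1 cpolyC// scale1r mul1r.
    have [d d0 dP] := IH (fun c cs => bb c (mem_behead (s := z :: s) cs)).
    have [d' d'0 d'P] := bb z (mem_head _ _).
    exists (d' * d); first exact: mulr_gt0.
    move=> v; rewrite big_cons cpolyM// cpolyXsubC// (le_trans _ (d'P _))//.
    by rewrite -mulrA ler_pM2l.
  exists (nrm (lead_coef (toC (q - m%:P))) * d).
    by rewrite mulr_gt0// lt_def nrm_ge0 nrm_eq0 c0.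
  move=> v; rewrite /D op_polyE// -/toC [in leRHS]rsE -mul_polyC cpolyM//.
  by rewrite cpolyC// nrmZ -mulrA ler_wpM2l ?nrm_ge0.
have [t tM zt] := not_bounded_below pA AM znbb.
have : root (toC (q - m%:P)) z.
  by rewrite rsE rootZ// root_prod_XsubC.
rewrite zt /root horner_map fmorph_eq0 !hornerE subr_eq0 => /eqP qt.
by have := q0 t tM; rewrite qt leNgt m_neg.
Qed.

(** Positivity of the polynomial c^2 - q^2. *)
Lemma op_poly_le A (M c : R) (q : {poly R}) x : positive_op A ->
  (forall v, nrm (A v) <= M * nrm v) -> 0 <= M -> 0 <= c ->
  (forall t, 0 <= t <= M -> `|q.[t]| <= c) ->
  nrm (op_poly q A x) <= c * nrm x.
Proof.
move=> pA AM M0 c0 qc; have lA := pA.1.1; have sA := positive_self_adjoint pA.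
have : 0 <= complex.Re (inner (op_poly ((c ^+ 2)%:P - q * q) A x) x).
  apply: (op_poly_ge0 _ pA AM) => // t /qc; rewrite !hornerE ler_norml.
  by move=> /andP[]; nra.
rewrite op_polyE// rmorphB/= map_polyC/= cpolyB// cpolyC//.
rewrite [map_poly _ _]rmorphM/= cpolyM//.
rewrite innerBl innerZl ReB Re_realM -nrm_sqr -!op_polyE//.
rewrite (op_poly_self_adjoint q sA) -nrm_sqr subr_ge0 -exprMn.
by apply: le_of_sqr; rewrite mulr_ge0// nrm_ge0.
Qed.

End positive_operators.

(** * Uniform approximation by polynomials *)

Section weierstrass.
Context {R : realType}.
Implicit Types (f : R -> R) (g h : nat -> R) (M p s t x : R).

(** Expectation of g at a binomial variable with n trials and success
    probability 'X, by conditioning on the first trial; these are the Bernstein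
    polynomials when g k = f (k / n). *)
Fixpoint bernstein n g : {poly R} :=
  if n is n'.+1 then 'X * bernstein n' (g \o S) + (1 - 'X) * bernstein n' g
  else (g 0%N)%:P.

Lemma bernsteinS n g x : (bernstein n.+1 g).[x] =
  x * (bernstein n (g \o S)).[x] + (1 - x) * (bernstein n g).[x].
Proof. by rewrite /= !hornerE. Qed.

Lemma bernstein_le n g h x : 0 <= x <= 1 ->
  (forall k, (k <= n)%N -> g k <= h k) ->
  (bernstein n g).[x] <= (bernstein n h).[x].
Proof.
move=> /andP[x0 x1]; elim: n g h => [|n IH] g h gh.
  by rewrite !hornerE gh.
rewrite !bernsteinS lerD// ler_wpM2l ?subr_ge0// IH// => k kn.
  exact: gh.
by rewrite gh// ltnW.
Qed.

Lemma bernstein_affine n g x a b :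
  (bernstein n (fun k => a + b * g k)).[x] = a + b * (bernstein n g).[x].
Proof.
elim: n g => [|n IH] g; first by rewrite !hornerE.
by rewrite !bernsteinS IH (IH (g \o S)); ring.
Qed.

Lemma bernstein_variance n x c :
  (bernstein n (fun k => (k%:R - c) ^+ 2)).[x] =
  (n%:R * x - c) ^+ 2 + n%:R * x * (1 - x).
Proof.
elim: n c => [|n IH] c; first by rewrite !hornerE; ring.
rewrite bernsteinS IH.
have -> : (fun k => (k%:R - c) ^+ 2) \o S =
    (fun k => (k%:R - (c - 1)) ^+ 2) :> (nat -> R).
  by apply/funext => k /=; rewrite -natr1; ring.
by rewrite IH -natr1; ring.
Qed.

(** On [0, M] this follows from continuity; it is the form of uniform continuity
    that pairs with the variance of a binomial variable. *)
Definition quadratic_modulus f M := forall e, 0 < e ->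
  exists2 K, 0 <= K & forall s t, 0 <= s <= M -> 0 <= t <= M ->
    `|f s - f t| <= e + K * (s - t) ^+ 2.

(** The deviation of f (k / n) from f x is at most e/2 + K (k / n - x)^2, whose
    mean is at most e/2 + K/n because a binomial variance is n x (1 - x). *)
Lemma bernstein_approx f e : quadratic_modulus f 1 -> 0 < e ->
  exists q : {poly R}, forall x, 0 <= x <= 1 -> `|q.[x] - f x| <= e.
Proof.
move=> fm e0; have e20 : 0 < e / 2 by rewrite divr_gt0.
have [K K0 fK] := fm _ e20.
have eK0 : 0 < e / 2 / (K + 1) by rewrite divr_gt0// ltr_wpDl.
have [n' /(_ _ (leqnn _)) Nn] := invS_le_eps eK0; pose n := n'.+1.
have n0 : 0 < n%:R :> R by rewrite ltr0n.
exists (bernstein n (fun k => f (k%:R / n%:R))) => x x01.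
pose dev (k : nat) := (k%:R - n%:R * x) ^+ 2; pose c := K / n%:R ^+ 2.
have Kn : K / n%:R <= e / 2.
  rewrite (le_trans (ler_wpM2l K0 Nn))// mulrCA ler_piMr ?(ltW e20)//.
  by rewrite ler_pdivrMr ?mul1r ?lerDl// ltr_wpDl.
have var : (bernstein n dev).[x] <= n%:R.
  rewrite bernstein_variance subrr expr0n add0r -mulrA ler_piMr ?ltW//.
  by case/andP: x01 => x0 x1; nra.
have mean s : (bernstein n (fun k => f x + s * (e / 2) + s * c * dev k)).[x] =
    f x + s * (e / 2 + c * (bernstein n dev).[x]).
  by rewrite bernstein_affine; ring.
have bnd : c * (bernstein n dev).[x] <= e / 2.
  apply: le_trans Kn; rewrite (@le_trans _ _ (c * n%:R))//.
    by rewrite ler_wpM2l// divr_ge0// sqr_ge0.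
  by rewrite /c expr2 invfM mulrA divfK ?gt_eqF.
have fk k : (k <= n)%N -> `|f (k%:R / n%:R) - f x| <= e / 2 + c * dev k.
  move=> kn; rewrite (le_trans (fK _ _ _ x01))//.
    by rewrite divr_ge0 ?ler0n//= ler_pdivrMr// mul1r ler_nat.
  rewrite lerD2l -mulrA ler_wpM2l// -exprVn -exprMn.
  have -> : n%:R^-1 * (k%:R - n%:R * x) = k%:R / n%:R - x.
    by field; rewrite gt_eqF.
  by [].
rewrite ler_distl; apply/andP; split.
  rewrite (@le_trans _ _ (f x + -1 * (e / 2 + c * (bernstein n dev).[x])))//.
    by move: bnd; set b := _ * _.[_]; lra.
  rewrite -mean; apply: bernstein_le => // k /fk.
  rewrite ler_norml => /andP[+ _].
  by clear mean bnd fk; move: c (dev k) (f _) => b u v; lra.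
rewrite (@le_trans _ _ (f x + 1 * (e / 2 + c * (bernstein n dev).[x])))//.
  rewrite -mean; apply: bernstein_le => // k /fk.
  rewrite ler_norml => /andP[_ +].
  by clear mean bnd fk; move: c (dev k) (f _) => b u v; lra.
by move: bnd; set b := _ * _.[_]; lra.
Qed.

Lemma weierstrass f M e : 0 < M -> quadratic_modulus f M -> 0 < e ->
  exists q : {poly R}, forall x, 0 <= x <= M -> `|q.[x] - f x| <= e.
Proof.
move=> M0 fm e0.
have scale s : 0 <= s <= 1 -> 0 <= M * s <= M.
  by move=> /andP[s0 s1]; have M0' := ltW M0; rewrite mulr_ge0//= ler_piMr.
have [|q qP] := @bernstein_approx (fun u => f (M * u)) e _ e0.
  move=> d /fm[K K0 fK]; exists (K * M ^+ 2).
    by rewrite mulr_ge0 ?sqr_ge0.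
  move=> s t /scale sM /scale tM; rewrite (le_trans (fK _ _ sM tM))//.
  by rewrite -mulrBr exprMn mulrA.
exists (q \Po (M^-1 *: 'X)) => x /andP[x0 xM].
have := qP (M^-1 * x); rewrite mulVKf ?gt_eqF// horner_comp !hornerE; apply.
by rewrite mulr_ge0 ?invr_ge0 ?(ltW M0)//= mulrC ler_pdivrMr// mul1r.
Qed.

(** Young's inequality: the graph of t |-> t^p lies above its tangent at m. *)
Lemma powR_tangent p m t : 1 <= p -> 0 <= m -> 0 <= t ->
  p * m `^ (p - 1) * t <= t `^ p + (p - 1) * m `^ p.
Proof.
move=> p1 m0 t0; move: (p1); rewrite le_eqVlt => /orP[/eqP <-|p1'].
  by rewrite subrr powRr0 mul0r addr0 !mul1r powRr1.
have p0 : 0 < p by rewrite (lt_trans ltr01).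
have q0 : 0 < p - 1 by rewrite subr_gt0.
have := @conjugate_powR _ t (m `^ (p - 1)) p (p / (p - 1)) t0 (powR_ge0 _ _) p0.
rewrite divr_gt0// -powRrM mulrCA divff ?gt_eqF// mulr1 invf_div => /(_ isT).
have -> : p^-1 + (p - 1) / p = 1 by field; rewrite gt_eqF.
move=> /(_ erefl) h.
rewrite -(ler_pM2l p0) in h; apply: le_trans (le_trans h _).
  by rewrite (mulrC t) mulrA.
rewrite mulrDr [p * (t `^ p / p)]mulrC divfK ?gt_eqF// lerD2l.
by rewrite [leLHS](_ : _ = (p - 1) * m `^ p)//; field; rewrite gt_eqF.
Qed.

Lemma powR_modulus p M : 1 <= p -> 0 < M ->
  quadratic_modulus (fun t => t `^ p) M.
Proof.
move=> p1 M0 e e0; pose L := p * M `^ (p - 1).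
have p0 : 0 <= p by rewrite (le_trans ler01).
have L0 : 0 <= L by rewrite mulr_ge0// powR_ge0.
exists (L ^+ 2 / (4 * e)); first by rewrite divr_ge0 ?sqr_ge0// mulr_ge0// ltW.
have lip s t : 0 <= t <= s -> s <= M -> `|s `^ p - t `^ p| <= L * (s - t).
  move=> /andP[t0 ts] sM; have s0 : 0 <= s by exact: le_trans ts.
  rewrite ger0_norm ?subr_ge0 ?ge0_ler_powR ?nnegrE//.
  have := powR_tangent p1 s0 t0.
  have -> : s `^ p = s * s `^ (p - 1).
    by rewrite mulr_powRB1// (lt_le_trans ltr01).
  have : s `^ (p - 1) <= M `^ (p - 1).
    by rewrite ge0_ler_powR ?nnegrE ?subr_ge0 ?(ltW M0).
  rewrite /L; move: (s `^ (p - 1)) (M `^ (p - 1)) (t `^ p) => a b c ab h.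
  have : p * a * (s - t) <= p * b * (s - t).
    by rewrite ler_wpM2r ?subr_ge0// ler_wpM2l.
  lra.
have amgm u : L * u <= e + L ^+ 2 / (4 * e) * u ^+ 2.
  rewrite -subr_ge0 [leRHS](_ : _ = (2 * e - L * u) ^+ 2 / (4 * e)).
    by rewrite divr_ge0 ?sqr_ge0// mulr_ge0// ltW.
  by field; rewrite gt_eqF.
move=> s t /andP[s0 sM] /andP[t0 tM]; have [ts|st] := leP t s.
  by apply: le_trans (amgm _); rewrite lip// t0.
rewrite distrC -[(s - t) ^+ 2]sqrrN opprB; apply: le_trans (amgm _).
by rewrite lip// s0 ltW.
Qed.

Lemma sqrt_modulus M : quadratic_modulus Num.sqrt M.
Proof.
move=> e e0; exists (e ^-1 ^+ 3); first by rewrite exprn_ge0// invr_ge0 ltW.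
move=> s t /andP[s0 _] /andP[t0 _].
have := sqr_sqrtr s0; have := sqr_sqrtr t0.
have := sqrtr_ge0 s; have := sqrtr_ge0 t.
move: (Num.sqrt s) (Num.sqrt t) => u v v0 u0 <- <-.
have [ue|eu] := leP `|u - v| e.
  by rewrite (le_trans ue)// lerDl mulr_ge0 ?sqr_ge0// exprn_ge0// invr_ge0 ltW.
set w := `|u - v|.
have w4 : w ^+ 4 <= (u ^+ 2 - v ^+ 2) ^+ 2.
  have -> : w ^+ 4 = ((u - v) ^+ 2) ^+ 2.
    by rewrite -[(u - v) ^+ 2]real_normK ?num_real// -exprM.
  have -> : (u ^+ 2 - v ^+ 2) ^+ 2 = (u - v) ^+ 2 * (u + v) ^+ 2 by ring.
  rewrite [leLHS]expr2 ler_wpM2l ?sqr_ge0//; nra.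
rewrite (@le_trans _ _ (e^-1 ^+ 3 * w ^+ 4))//; last first.
  rewrite ler_wpDl ?(ltW e0)// ler_wpM2l// exprn_ge0// invr_ge0 ltW//.
have w0 : 0 < w by exact: lt_trans eu.
rewrite -[X in X <= _]mul1r [w ^+ 4]exprSr mulrA ler_pM2r// -exprMn.
rewrite exprn_ege1//.
by rewrite mulrC ler_pdivlMr// mul1r ltW.
Qed.

End weierstrass.

(** * Functional calculus of positive operators *)

Section uniform_convergence.

Lemma uniform_cvg_normP (K : numFieldType) (U : choiceType)
    (V : normedModType K) (D : set U) (u : nat -> U -> V) (f : U -> V) :
  {uniform D, u @ \oo --> f} <->
  forall e : K, 0 < e -> exists N, forall n, (N <= n)%N ->
    forall x, D x -> `|f x - u n x| < e.
Proof.
split=> [uf e e0|h P].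
  have : nbhs (f : {uniform` D -> V})
      [set g : U -> V | forall x, D x -> `|f x - g x| < e].
    apply/uniform_nbhs; exists [set xy | ball xy.1 e xy.2]; split.
      exact: entourage_ball (PosNum e0).
    by move=> g gP x /gP; rewrite -ball_normE.
  by move=> /uf[N _ NP]; exists N => n Nn; exact: NP.
move=> /uniform_nbhs[E [+ EP]].
rewrite -entourage_ballE => -[e e0 eE]; have [N NP] := h _ e0.
exists N => // n Nn; apply: EP => x Dx; apply: eE.
by rewrite -ball_normE/=; exact: NP.
Qed.

End uniform_convergence.

Section functional_calculus.
Context {R : realType} {H : hilbertType R}.
Implicit Types (x y : H) (A B : H -> H) (f : R -> R) (M e t : R).

Lemma op_poly_linear q A : linear A -> linear (op_poly q A).
Proof. by move=> lA a u v; rewrite !op_polyE// cpoly_linear. Qed.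

Lemma eq0_le_invS (V : normedZmodType R[i]) (v : V) (c : R) :
  (forall n, nrm v <= n.+1%:R^-1 * c) -> v = 0.
Proof.
move=> vc; apply/eqP; rewrite -nrm_eq0 eq_le nrm_ge0 andbT.
apply: eq0_le_eps => e e0; have c0 : 0 < `|c| + 1 by rewrite ltr_wpDl.
have ec0 : 0 < e / (`|c| + 1) by rewrite divr_gt0.
have [N /(_ _ (leqnn _)) Ne] := invS_le_eps ec0.
rewrite (le_trans (vc N))// (@le_trans _ _ (N.+1%:R^-1 * (`|c| + 1)))//.
  by rewrite ler_wpM2l ?(ltW (invS_gt0 _))// ler_wpDr// ler_norm.
by rewrite -ler_pdivlMr.
Qed.

(** Approximation of the pair (f, B) by pairs (q, q(A)), uniform on [0, M] on
    the one side and relative to the norm of an arbitrary vector on the other. *)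
Lemma fun_calcP f A B : linear A -> is_fun_calc f A B -> exists2 M,
  forall x, nrm (A x) <= M * nrm x &
  forall e, 0 < e -> exists2 q : {poly R},
    forall t, 0 <= t <= M -> `|q.[t] - f t| <= e &
    forall x, nrm (op_poly q A x - B x) <= e * nrm x.
Proof.
move=> lA [[lB _] [M [q [AM /uniform_cvg_normP qf /uniform_cvg_normP qB]]]].
have {}AM x : nrm (A x) <= M * nrm x.
  by have := AM x; rewrite !norm_nrm -rmorphM/= lecR.
exists M => // e e0; have e0c : 0 < e%:C by rewrite ltcR.
have [N1 h1] := qf _ e0; have [N2 h2] := qB _ e0c.
exists (q (maxn N1 N2)).
  by move=> t tM; rewrite distrC ltW// h1 ?leq_maxl//= in_itv.
move=> x; have [->|x0] := eqVneq x 0.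
  by rewrite (lin_map0 (op_poly_linear _ lA)) (lin_map0 lB) subrr !nrm0 mulr0.
have nx : 0 < nrm x by rewrite lt_def nrm_ge0 nrm_eq0 x0.
have := h2 _ (leq_maxr N1 N2) ((nrm x)^-1%:C *: x).
rewrite (lin_mapZ (op_poly_linear _ lA)) (lin_mapZ lB) -scalerBr /=.
rewrite !norm_nrm !nrmZ !nrm_real gtr0_norm ?invr_gt0//.
rewrite mulVf ?gt_eqF// lexx => /(_ isT); rewrite ltcR mulrC.
by rewrite ltr_pdivrMr// nrm_distC => /ltW.
Qed.

(** Existence: along polynomials converging to f, the operators q(A) are Cauchy
    in norm by op_poly_le. *)
Lemma fun_calc_ex f A : positive_op A ->
  (forall M, 0 < M -> quadratic_modulus f M) -> exists B, is_fun_calc f A B.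
Proof.
move=> pA fm; have lA := pA.1.1; have [M M0 AM] := bounded_op_nrm pA.1.
have M0' := ltW M0.
have /choice[q qP] : forall n : nat, exists q : {poly R},
    forall t, 0 <= t <= M -> `|q.[t] - f t| <= n.+1%:R^-1.
  by move=> n; exact: weierstrass M0 (fm _ M0) (invS_gt0 n).
have cau i j x : nrm (op_poly (q i) A x - op_poly (q j) A x) <=
    (i.+1%:R^-1 + j.+1%:R^-1) * nrm x.
  have -> : op_poly (q i) A x - op_poly (q j) A x = op_poly (q i - q j) A x.
    by rewrite !op_polyE// rmorphB/= cpolyB.
  apply: (op_poly_le _ pA AM) => // t tM; rewrite !hornerE.
  have -> : (q i).[t] - (q j).[t] = ((q i).[t] - f t) - ((q j).[t] - f t).
    by rewrite opprB addrA subrK.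
  by rewrite (le_trans (ler_normB _ _))// lerD// qP.
have /choice[B BP] : forall x, exists y, forall e, 0 < e -> exists N,
    forall i, (N <= i)%N -> nrm (op_poly (q i) A x - y) <= e.
  move=> x; apply: cauchy_seq_cvg => e e0.
  have e1 : 0 < e / 2 / (nrm x + 1).
    by rewrite !divr_gt0// ltr_wpDl// nrm_ge0.
  have [N Ne] := invS_le_eps e1; exists N => i j /Ne Ni /Ne Nj.
  rewrite (le_trans (cau i j x))//.
  rewrite (@le_trans _ _ (e / (nrm x + 1) * (nrm x + 1)))//; last first.
    by rewrite divfK// gt_eqF// ltr_wpDl// nrm_ge0.
  rewrite ler_pM ?nrm_ge0 ?lerDl//.
  rewrite [e in leRHS]splitr mulrDl lerD//.
have rate n x : nrm (op_poly (q n) A x - B x) <= n.+1%:R^-1 * nrm x.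
  apply/ler_addgt0Pr => e e0; have e20 : 0 < e / 2 by rewrite divr_gt0.
  have [N1 h1] := BP x _ e20.
  have e1 : 0 < e / 2 / (nrm x + 1).
    by rewrite !divr_gt0// ltr_wpDl// nrm_ge0.
  have [N2 h2] := invS_le_eps e1; pose m := maxn N1 N2.
  have {}h1 := h1 m (leq_maxl _ _); have {}h2 := h2 m (leq_maxr _ _).
  have -> : op_poly (q n) A x - B x = (op_poly (q n) A x - op_poly (q m) A x) +
      (op_poly (q m) A x - B x) by rewrite addrA subrK.
  rewrite (le_trans (ler_nrmD _ _))// [e in leRHS]splitr addrA lerD//.
  rewrite (le_trans (cau n m x))// mulrDl lerD2l.
  rewrite (le_trans (ler_wpM2r (nrm_ge0 _) h2))// mulrAC -mulrA.
  rewrite ler_piMr ?(ltW e20)// ler_pdivrMr ?mul1r ?lerDl//.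
  by rewrite ltr_wpDl// nrm_ge0.
have lB : linear B.
  move=> a x y; apply/eqP; rewrite -subr_eq0; apply/eqP.
  apply: (@eq0_le_invS _ _ (nrm (a *: x + y) + nrm a * nrm x + nrm y)) => n.
  have -> : B (a *: x + y) - (a *: B x + B y) =
     - (op_poly (q n) A (a *: x + y) - B (a *: x + y)) +
     a *: (op_poly (q n) A x - B x) + (op_poly (q n) A y - B y).
    rewrite (op_poly_linear _ lA) scalerBr -[RHS]addrA [X in _ = _ + X]addrACA.
    by rewrite -opprD opprB addrA subrK.
  rewrite !mulrDr (le_trans (ler_nrmD _ _))// lerD ?rate//.
  rewrite (le_trans (ler_nrmD _ _))// nrmN lerD ?rate//.
  by rewrite nrmZ mulrCA ler_wpM2l ?nrm_ge0// rate.
exists B; split.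
  have [K K0 qK] := cpoly_bound (map_poly (real_complex R) (q 0%N)) AM M0'.
  apply: (@bounded_opI _ _ _ (K + 1)) => // x.
  have -> : B x = op_poly (q 0%N) A x - (op_poly (q 0%N) A x - B x).
    by rewrite opprB addrC subrK.
  rewrite (le_trans (ler_nrmB _ _))// mulrDl lerD ?op_polyE//.
  by rewrite -op_polyE// (le_trans (rate _ _))// invr1.
exists M, q; split.
- by move=> x; rewrite !norm_nrm -rmorphM/= lecR.
- apply/uniform_cvg_normP => e e0; have e20 : 0 < e / 2 by rewrite divr_gt0.
  have [N Ne] := invS_le_eps e20; exists N => n /Ne Nn t; rewrite /= in_itv/=.
  move=> tM; rewrite distrC (le_lt_trans (qP n t tM))// (le_lt_trans Nn)//.
  by rewrite ltr_pdivrMr// ltr_pMr// ltr1n.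
- apply/uniform_cvg_normP => e e0.
  have eE : e = (complex.Re e)%:C by rewrite RRe_real// gtr0_real.
  move: e0; rewrite eE ltcR => e0.
  have e20 : 0 < complex.Re e / 2 by rewrite divr_gt0.
  have [N Ne] := invS_le_eps e20; exists N => n /Ne Nn x /=.
  rewrite !norm_nrm lecR ltcR nrm_distC => x1.
  rewrite (le_lt_trans (rate n x))// (@le_lt_trans _ _ (n.+1%:R^-1))//.
    by rewrite ler_piMr// ltW// invS_gt0.
  by rewrite (le_lt_trans Nn)// ltr_pdivrMr// ltr_pMr// ltr1n.
Qed.

Lemma fun_calc_self_adjoint f A B : positive_op A -> is_fun_calc f A B ->
  self_adjoint B.
Proof.
move=> pA fAB x y; have [M AM AB] := fun_calcP pA.1.1 fAB.
apply/eqP; rewrite -subr_eq0; apply/eqP.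
apply: (@eq0_le_invS _ _ (nrm x * nrm y + nrm x * nrm y)) => n.
have [q _ qB] := AB _ (invS_gt0 n).
have -> : inner (B x) y - inner x (B y) =
    inner x (op_poly q A y - B y) - inner (op_poly q A x - B x) y.
  rewrite innerBl innerBr (op_poly_self_adjoint q (positive_self_adjoint pA)).
  by rewrite opprB [RHS]addrC addrA subrK.
rewrite (le_trans (ler_nrmB _ _))// mulrDr lerD//.
  rewrite (le_trans (cauchy_schwarz _ _))// mulrCA ler_wpM2l ?nrm_ge0//.
by rewrite (le_trans (cauchy_schwarz _ _))// mulrA ler_wpM2r ?nrm_ge0.
Qed.

(** The polynomial c + |k| e' + k q + d t, in which |k| e' absorbs the error
    made by replacing f with q, is nonnegative on [0, M]. *)
Lemma fun_calc_ge0 f A B (c k d : R) x : positive_op A -> is_fun_calc f A B ->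
  (forall t, 0 <= t -> 0 <= c + k * f t + d * t) ->
  0 <= c * nrm x ^+ 2 + k * complex.Re (inner (B x) x) +
       d * complex.Re (inner (A x) x).
Proof.
move=> pA fAB ckd; have lA := pA.1.1; have [M AM AB] := fun_calcP lA fAB.
have [->|x0] := eqVneq x 0.
  by rewrite nrm0 !inner0r/= !mulr0 expr0n mulr0 !addr0.
have nx : 0 < nrm x by rewrite lt_def nrm_ge0 nrm_eq0 x0.
have M0 : 0 <= M.
  by rewrite -(ler_pM2r nx) mul0r (le_trans _ (AM x))// nrm_ge0.
rewrite -oppr_le0; apply: eq0_le_eps => e e0.
have k0 : 0 < `|k| + 1 by rewrite ltr_wpDl.
have [e' e'0 ee] : exists2 e', 0 < e' & `|k| * e' * nrm x ^+ 2 * 2 <= e.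
  exists (e / (2 * nrm x ^+ 2 * (`|k| + 1))).
    by rewrite divr_gt0// !mulr_gt0// exprn_gt0.
  rewrite (_ : _ * 2 = e * (`|k| / (`|k| + 1))).
    by rewrite ler_piMr ?(ltW e0)// ler_pdivrMr// mul1r lerDl.
  by field; rewrite !gt_eqF.
have [q qf qB] := AB _ e'0.
pose r := (c + `|k| * e')%:P + k%:P * q + d%:P * 'X.
have : 0 <= complex.Re (inner (op_poly r A x) x).
  apply: (op_poly_ge0 _ pA AM) => // t tM.
  rewrite /r !hornerD !hornerM !hornerC hornerX.
  have /ckd := (andP tM).1; have := qf _ tM.
  move: (q.[t]) (f t) => u v uv h.
  have : `|k * (u - v)| <= `|k| * e' by rewrite normrM ler_wpM2l.
  rewrite ler_norml => /andP[]; move: (`|k| * e') h => w; lra.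
rewrite op_polyE// !rmorphD/= !rmorphM/= !map_polyC/= map_polyX/= !cpolyD//.
rewrite !cpolyM// !cpolyC// cpolyX// -op_polyE// !innerDl !innerZl.
rewrite !ReD !Re_realM -nrm_sqr; set a := complex.Re _.
set b := complex.Re _ => h.
have kB : `|k * (a - complex.Re (inner (B x) x))| <= `|k| * (e' * nrm x ^+ 2).
  rewrite normrM ler_wpM2l// /a -ReB -innerBl.
  have qBx v : nrm v <= e' * nrm x -> complex.Re (inner v x) <= e' * nrm x ^+ 2.
    move=> vx; rewrite (le_trans (Re_inner_le _ _))// expr2 mulrA.
    by rewrite ler_wpM2r ?nrm_ge0.
  rewrite ler_norml qBx ?qB// andbT lerNl.
  have -> : - complex.Re (inner (op_poly q A x - B x) x) =
      complex.Re (inner (- (op_poly q A x - B x)) x).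
    by rewrite innerNl; case: (inner _ _).
  by rewrite qBx// nrmN qB.
move: kB; rewrite ler_norml => /andP[]; move: h ee.
move: (complex.Re (inner (B x) x)) (nrm x ^+ 2) (`|k|) => u w k'; lra.
Qed.

Lemma fun_calc_positive f A B : positive_op A -> is_fun_calc f A B ->
  (forall t, 0 <= t -> 0 <= f t) -> positive_op B.
Proof.
move=> pA fAB f0; split=> [|x]; first by case: fAB.
have sB := fun_calc_self_adjoint pA fAB.
have /complex_realP[r rE] : inner (B x) x \is Num.real.
  apply/complex_realP; exists (complex.Re (inner (B x) x)).
  have := innerC (B x) x; rewrite -sB; case: (inner (B x) x) => a b /= [].
  by move=> /eqP; rewrite -subr_eq0 opprK -mulr2n mulrn_eq0/= => /eqP ->.
have := @fun_calc_ge0 f A B 0 1 0 x pA fAB.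
rewrite rE/= mul0r add0r mul1r mul0r addr0 ler0c; apply => t /f0.
by rewrite add0r mul1r mul0r addr0.
Qed.

Lemma fun_calc_eigen f A B x (a : R) : positive_op A -> is_fun_calc f A B ->
  x != 0 -> A x = a%:C *: x -> B x = (f a)%:C *: x.
Proof.
move=> pA fAB x0 Ax; have [M AM AB] := fun_calcP pA.1.1 fAB.
have nx : 0 < nrm x by rewrite lt_def nrm_ge0 nrm_eq0 x0.
have aM : 0 <= a <= M.
  have := positive_Re_ge0 x pA.
  rewrite Ax innerZl Re_realM -nrm_sqr pmulr_lge0 ?exprn_gt0// => a0.
  by have := AM x; rewrite Ax nrmZ nrm_real ger0_norm// ler_pM2r// a0.
apply/eqP; rewrite -subr_eq0; apply/eqP.
apply: (@eq0_le_invS _ _ (nrm x + nrm x)) => n.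
have [q qf qB] := AB _ (invS_gt0 n).
have -> : B x - (f a)%:C *: x =
    (q.[a] - f a)%:C *: x - (op_poly q A x - B x).
  rewrite op_polyE ?(cpoly_eigen pA.1.1 _ Ax)// horner_map/=.
  by rewrite rmorphB scalerBl opprB [RHS]addrC addrA subrK.
rewrite (le_trans (ler_nrmB _ _))// mulrDr lerD//.
by rewrite nrmZ nrm_real ler_wpM2r ?nrm_ge0// qf.
Qed.

Lemma fun_calc_sqrt A B : positive_op A -> is_fun_calc Num.sqrt A B ->
  B \o B = A.
Proof.
move=> pA fAB; have lA := pA.1.1; have [M AM AB] := fun_calcP lA fAB.
have bB : bounded_op B by case: fAB.
have [K K0 BK] := bounded_op_nrm bB.
apply/funext => x /=; apply/eqP; rewrite -subr_eq0; apply/eqP.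
have [->|x0] := eqVneq x 0.
  by rewrite !(lin_map0 bB.1) (lin_map0 lA) subrr.
have nx : 0 < nrm x by rewrite lt_def nrm_ge0 nrm_eq0 x0.
have M0 : 0 <= M.
  by rewrite -(ler_pM2r nx) mul0r (le_trans _ (AM x))// nrm_ge0.
apply: (@eq0_le_invS _ _ ((K + (K + 1) + (2 * Num.sqrt M + 1)) * nrm x)) => n.
set e := n.+1%:R^-1; have e0 : 0 < e by exact: invS_gt0.
have e1 : e <= 1 by rewrite invf_le1 ?ltr0n// ler1n.
have [q qf qB] := AB _ e0.
have qK : nrm (op_poly q A x) <= (K + 1) * nrm x.
  have -> : op_poly q A x = B x + (op_poly q A x - B x) by rewrite addrC subrK.
  rewrite (le_trans (ler_nrmD _ _))// mulrDl lerD// (le_trans (qB x))//.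
  by rewrite ler_wpM2r ?nrm_ge0.
have qq : nrm (op_poly (q * q - 'X) A x) <= e * (2 * Num.sqrt M + 1) * nrm x.
  apply: (op_poly_le _ pA AM) => //.
    by rewrite mulr_ge0 ?(ltW e0)// addr_ge0// mulr_ge0// sqrtr_ge0.
  move=> t /[dup] /qf qt /andP[t0 tM].
  rewrite hornerD hornerN hornerM hornerX.
  have -> : q.[t] * q.[t] - t = (q.[t] - Num.sqrt t) * (q.[t] + Num.sqrt t).
    by rewrite -[X in _ - X = _](sqr_sqrtr t0) -expr2 subr_sqr.
  rewrite normrM ler_pM//.
  have -> : q.[t] + Num.sqrt t = (q.[t] - Num.sqrt t) + 2 * Num.sqrt t by ring.
  rewrite (le_trans (ler_normD _ _))// addrC lerD ?(le_trans qt)//.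
  by rewrite normrM !ger0_norm ?sqrtr_ge0// ler_pM2l// ler_wsqrtr.
have -> : B (B x) - A x = - B (op_poly q A x - B x) -
   (op_poly q A (op_poly q A x) - B (op_poly q A x)) + op_poly (q * q - 'X) A x.
  rewrite [op_poly (q * q - 'X) A x]op_polyE// rmorphB rmorphM/= cpolyB//.
  rewrite cpolyM// map_polyX cpolyX// -!op_polyE// (lin_mapB bB.1) !opprB.
  by rewrite !subrKA.
have -> : e * ((K + (K + 1) + (2 * Num.sqrt M + 1)) * nrm x) =
    K * (e * nrm x) + e * ((K + 1) * nrm x) +
    e * (2 * Num.sqrt M + 1) * nrm x.
  by move: (Num.sqrt M) (nrm x) e {e0 e1 qf qB qK qq nx} => r w e; ring.
rewrite (le_trans (ler_nrmD _ _))// lerD//.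
rewrite (le_trans (ler_nrmB _ _))// nrmN lerD//.
  by rewrite (le_trans (BK _))// ler_pM2l.
by rewrite (le_trans (qB _))// ler_pM2l.
Qed.

Lemma op_sqrtP A : positive_op A ->
  positive_op (op_sqrt A) /\ op_sqrt A \o op_sqrt A = A.
Proof.
move=> pA; have [|B fAB] := @fun_calc_ex Num.sqrt A pA.
  by move=> M _; exact: sqrt_modulus.
suff : exists S, positive_op S /\ S \o S = A.
  case=> S SP; exact: (@xgetPex _ 0
    (fun S => positive_op S /\ S \o S = A) (ex_intro _ S SP)).
exists B; split; last exact: fun_calc_sqrt fAB.
by apply: fun_calc_positive pA fAB _ => t _; exact: sqrtr_ge0.
Qed.

Lemma op_powP A (p : R) : positive_op A -> 1 <= p ->
  is_fun_calc (fun t => t `^ p) A (op_pow A p).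
Proof.
move=> pA p1; have [|B fAB] := @fun_calc_ex (fun t => t `^ p) A pA.
  by move=> M M0; exact: powR_modulus.
exact: (@xgetPex _ 0 (is_fun_calc (fun t => t `^ p) A) (ex_intro _ B fAB)).
Qed.

End functional_calculus.

(** * Compact operators *)

Section compact_operators.
Context {R : realType} {H : hilbertType R}.
Implicit Types (x y v w : H) (A B S T : H -> H) (E F : set H).

(** Norm smallness off a finite set of vectors: this says that T is a norm limit
    of finite rank operators, and passes to adjoints without projections. *)
Definition compact_op T := forall e : R, 0 < e -> exists s : seq H,
  forall x, (forall v, v \in s -> inner x v = 0) -> nrm (T x) <= e * nrm x.

Lemma compact_op_le B S :
  (forall x, nrm (S x) <= nrm (B x)) -> compact_op B -> compact_op S.
Proof.
move=> SB cB e /cB[s sP]; exists s => x /sP; exact: le_trans.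
Qed.

Lemma compact_opD S T : compact_op S -> compact_op T ->
  compact_op (fun x => S x + T x).
Proof.
move=> cS cT e e0; have e20 : 0 < e / 2 by rewrite divr_gt0.
have [s sP] := cS _ e20; have [t tP] := cT _ e20; exists (s ++ t) => x xP.
rewrite (le_trans (ler_nrmD _ _))// [e in leRHS]splitr mulrDl lerD//.
  by apply: sP => v vs; apply: xP; rewrite mem_cat vs.
by apply: tP => v vs; apply: xP; rewrite mem_cat vs orbT.
Qed.

Lemma compact_opZ a T : compact_op T -> compact_op (fun x => a *: T x).
Proof.
move=> cT e e0; have a0 : 0 < nrm a + 1 by rewrite ltr_wpDl ?nrm_ge0.
have ea0 : 0 < e / (nrm a + 1) by rewrite divr_gt0.
have [s sP] := cT _ ea0; exists s => x /sP xP; rewrite nrmZ.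
rewrite (le_trans (ler_wpM2l (nrm_ge0 a) xP))// mulrA ler_wpM2r ?nrm_ge0//.
by rewrite mulrCA ler_piMr ?(ltW e0)// ler_pdivrMr// mul1r lerDl.
Qed.

(** If x is orthogonal to T v for all v in s, then T^* x is orthogonal to s. *)
Lemma compact_adjoint T : bounded_op T -> compact_op T ->
  compact_op (adjoint T).
Proof.
move=> bT cT e e0; have [s sP] := cT _ e0; exists (map T s) => x xP.
set y := adjoint T x; have [->|y0] := eqVneq y 0.
  by rewrite nrm0 mulr_ge0 ?(ltW e0) ?nrm_ge0.
have ny : 0 < nrm y by rewrite lt_def nrm_ge0 nrm_eq0 y0.
rewrite -(ler_pM2r ny) -expr2 nrm_sqr {2}/y -adjointE//.
rewrite (le_trans (Re_inner_le _ _))// mulrAC ler_wpM2r ?nrm_ge0//.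
apply: sP => v vs; rewrite /y -adjointEr//.
by apply: xP; apply: map_f.
Qed.

(** * Eigenvectors of compact positive operators *)

Lemma gram_schmidt (s : seq H) : exists t, [/\ uniq t,
  orthonormal_on [set` t] id &
  forall x, (forall v, v \in t -> inner x v = 0) ->
    forall v, v \in s -> inner x v = 0].
Proof.
elim: s => [|v s [t [ut ot ts]]]; first by exists [::]; split.
pose p := \sum_(u <- t) inner v u *: u.
have tT u : u \in t -> [set` t] u by [].
have pv u : u \in t -> inner (v - p) u = 0.
  by move=> ut'; rewrite innerBl /p (inner_comb ot ut tT) ?subrr.
have xp x : (forall u, u \in t -> inner x u = 0) -> inner x p = 0.
  move=> xt; rewrite inner_sumr big_seq big1// => u /xt xu.
  by rewrite innerZr xu mulr0.
have [vp|vp0] := eqVneq (v - p) 0.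
  exists t; split=> // x xt w; rewrite inE => /orP[/eqP->|]; last exact: ts.
  by rewrite -[v](subrK p) vp add0r xp.
have n0 : 0 < nrm (v - p) by rewrite lt_def nrm_ge0 nrm_eq0 vp0.
pose e := (nrm (v - p))^-1%:C *: (v - p).
have e1 : inner e e = 1.
  rewrite inner_nrm nrmZ nrm_real gtr0_norm ?invr_gt0// mulVf ?gt_eqF//.
  by rewrite expr1n.
have et u : u \in t -> inner e u = 0 by move=> ?; rewrite innerZl pv ?mulr0.
have e_t : e \notin t.
  by apply/negP => /et/eqP; rewrite e1 oner_eq0.
exists (e :: t); split; first by rewrite /= e_t.
- move=> a b /=; rewrite !inE => /orP[/eqP->|at'] /orP[/eqP->|bt].
  + by rewrite e1 eqxx.
  + by rewrite et//; case: eqP => // eb; rewrite eb bt in e_t.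
  + rewrite (inner_eq0C (et _ at')); case: eqP => // ae.
    by rewrite -ae at' in e_t.
  + exact: ot.
- move=> x xt w; rewrite inE => /orP[/eqP->|ws]; last first.
    by apply: ts ws => u ut'; apply: xt; rewrite inE ut' orbT.
  rewrite -[v](subrK p) innerDr xp ?addr0; last first.
    by move=> u ut'; apply: xt; rewrite inE ut' orbT.
  have := xt e (mem_head _ _); rewrite innerZr => /eqP.
  rewrite mulf_eq0 conjc_eq0 => /orP[/eqP[/eqP]|/eqP//].
  by rewrite invr_eq0 gt_eqF.
Qed.

(** The ultrafilter decides for each a whether a <= f n; the limit is the
    supremum of the a for which it does. *)
Lemma ultra_bounded_cvg (G : set_system nat) (f : nat -> R) (c : R) :
  UltraFilter G -> (forall n, `|f n| <= c) ->
  exists l, forall e, 0 < e -> G [set n | `|f n - l| <= e].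
Proof.
move=> UG fc; pose S := [set a | G [set n | a <= f n]].
have supS : has_sup S.
  split; first exists (- c).
    rewrite /S /=; suff -> : [set n | - c <= f n] = setT by exact: filterT.
    apply/seteqP; split=> // n _ /=.
    by have := fc n; rewrite ler_norml => /andP[].
  exists c => a /filter_ex[n /= an]; rewrite (le_trans an)//.
  by have := fc n; rewrite ler_norml => /andP[].
exists (sup S) => e e0.
have [a Sa la] := sup_adherent e0 supS.
have h : G (~` [set n | sup S + e <= f n]).
  have [Sle|//] := in_ultra_setVsetC [set n | sup S + e <= f n] UG.
  have := ub_le_sup supS.2 Sle; rewrite gerDl => /le_lt_trans /(_ e0).
  by rewrite ltxx.
apply: (@filterS _ G _ _ _ _ (filterI Sa h)) => n [/= an /negP].
by rewrite -ltNge => nl; rewrite ler_norml; apply/andP; split; lra.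
Qed.

Lemma ultra_inner_cvg (G : set_system nat) (u : nat -> H) (s : seq H) :
  UltraFilter G -> (forall n, nrm (u n) <= 1) ->
  forall e : R, 0 < e -> exists2 A, G A & forall i j, A i -> A j ->
    forall v, v \in s -> nrm (inner (u i - u j) v) <= e.
Proof.
move=> UG u1; elim: s => [|v s IH] e e0.
  by exists setT => //; exact: filterT.
have [A GA AP] := IH _ e0.
have uv n : nrm (inner (u n) v) <= nrm v.
  by rewrite (le_trans (cauchy_schwarz _ _))// ler_piMl ?nrm_ge0.
have e40 : 0 < e / 4 by rewrite divr_gt0.
have [n|a /(_ _ e40) aP] :=
    @ultra_bounded_cvg _ (fun n => complex.Re (inner (u n) v)) (nrm v) UG.
  apply: le_trans (uv n); apply: le_of_sqr; first exact: nrm_ge0.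
  by rewrite nrm_sqrE real_normK ?num_real// lerDl sqr_ge0.
have [n|b /(_ _ e40) bP] :=
    @ultra_bounded_cvg _ (fun n => complex.Im (inner (u n) v)) (nrm v) UG.
  by rewrite (le_trans (Im_le_nrm _)).
exists (A `&` ([set n | `|complex.Re (inner (u n) v) - a| <= e / 4] `&`
   [set n | `|complex.Im (inner (u n) v) - b| <= e / 4])).
  by apply: filterI => //; exact: filterI.
move=> i j [Ai [ai bi]] [Aj [aj bj]] w.
rewrite inE => /orP[/eqP->|]; last exact: AP.
apply: le_of_sqr; first exact: ltW.
rewrite nrm_sqrE innerBl; move: ai bi aj bj => /=.
case: (inner (u i) v) (inner (u j) v) => a1 b1 [a2 b2] /=.
rewrite !ler_norml => /andP[? ?] /andP[? ?] /andP[? ?] /andP[? ?].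
have h1 : (a1 - a2) ^+ 2 <= (e / 2) ^+ 2.
  by rewrite -subr_ge0 subr_sqr mulr_ge0//; lra.
have h2 : (b1 - b2) ^+ 2 <= (e / 2) ^+ 2.
  by rewrite -subr_ge0 subr_sqr mulr_ge0//; lra.
by rewrite (le_trans (lerD h1 h2))//; have := sqr_ge0 e; lra.
Qed.

(** Unit vectors of the invariant subspace on which the quadratic form tends to
    its supremum m are approximate eigenvectors; off a finite set of directions
    B is smaller than m/4, and in those directions they converge along an
    ultrafilter, so that they converge in norm. *)
Lemma compact_eigenvector B F : positive_op B -> compact_op B ->
  (forall x, orthocompl F x -> orthocompl F (B x)) ->
  (exists2 x, orthocompl F x & B x != 0) ->
  exists x (a : R), [/\ orthocompl F x, x != 0 & B x = a%:C *: x].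
Proof.
move=> pB cB BN [x0 Nx0 Bx0]; have lB := pB.1.1.
have sB := positive_self_adjoint pB.
have [K K0 BK] := bounded_op_nrm pB.1.
pose N := orthocompl F.
have NP a x y : N x -> N y -> N (a *: x + y).
  by move=> Nx Ny v Fv; rewrite innerDl innerZl Nx// Ny// mulr0 addr0.
have N0 : N 0 by move=> v _; rewrite inner0l.
have NZ a x : N x -> N (a *: x) by move=> Nx; rewrite -[_ *: _]addr0; exact: NP.
have NB x y : N x -> N y -> N (x - y).
  by move=> Nx Ny; rewrite addrC -scaleN1r; exact: NP.
pose num x := complex.Re (inner (B x) x).
have numZ (a : R) y : num (a%:C *: y) = a ^+ 2 * num y.
  rewrite /num (lin_mapZ lB) innerZl innerZr conjc_real !Re_realM.
  by rewrite mulrA expr2.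
have unit y : 0 < nrm y -> nrm ((nrm y)^-1%:C *: y) = 1.
  by move=> y0; rewrite nrmZ nrm_real gtr0_norm ?invr_gt0// mulVf ?gt_eqF.
have num0 : 0 < num x0.
  have := nrm_sqr_le_form (x := x0) lB sB K0 BK (fun k => positive_Re_ge0 _ pB).
  rewrite -/(num _) => h; rewrite -(pmulr_rgt0 _ K0); apply: lt_le_trans h.
  by rewrite exprn_gt0// lt_def nrm_ge0 nrm_eq0 Bx0.
have nx0 : 0 < nrm x0.
  rewrite lt_def nrm_ge0 nrm_eq0 andbT; apply: contraNneq Bx0 => ->.
  by rewrite (lin_map0 lB).
pose S := [set num y | y in [set y | N y /\ nrm y = 1]].
have supS : has_sup S.
  split.
    exists (num ((nrm x0)^-1%:C *: x0)); exists ((nrm x0)^-1%:C *: x0) => //.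
    by split; [exact: NZ|exact: unit].
  exists K => _ [y [_ y1] <-]; rewrite /num (le_trans (Re_inner_le _ _))//.
  by rewrite y1 mulr1 (le_trans (BK _))// y1 mulr1.
pose m := sup S.
have m_ub y : N y -> num y <= m * nrm y ^+ 2.
  move=> Ny; have [y0|] := ltP 0 (nrm y); last first.
    rewrite le_eqVlt ltNge nrm_ge0 orbF nrm_eq0 => /eqP ->.
    by rewrite nrm0 expr0n mulr0 /num inner0r.
  have : num ((nrm y)^-1%:C *: y) <= m.
    apply: (ub_le_sup supS.2); exists ((nrm y)^-1%:C *: y) => //.
    by split; [exact: NZ|exact: unit].
  by rewrite numZ exprVn mulrC ler_pdivrMr ?exprn_gt0.
have m0 : 0 < m.
  by have := lt_le_trans num0 (m_ub _ Nx0); rewrite pmulr_lgt0// exprn_gt0.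
have /choice[u uP] : forall n : nat, exists y,
    [/\ N y, nrm y = 1 & m - n.+1%:R^-1 <= num y].
  move=> n; have [_ [y [Ny y1] <-] /ltW h] := sup_adherent (invS_gt0 n) supS.
  by exists y; split.
have uN n : N (u n) by case: (uP n).
have u1 n : nrm (u n) = 1 by case: (uP n).
pose D x := m%:C *: x - B x.
have lD : linear D.
  by move=> a x y; rewrite /D lB scalerDr opprD addrACA scalerBr !scalerA mulrC.
have sD : self_adjoint D.
  by move=> x y; rewrite /D innerBl innerBr innerZl innerZr conjc_real sB.
have L0 : 0 < m + K by rewrite addr_gt0.
have DL v : nrm (D v) <= (m + K) * nrm v.
  rewrite (le_trans (ler_nrmB _ _))// mulrDl lerD// nrmZ nrm_real gtr0_norm//.
have D_approx n : nrm (D (u n)) ^+ 2 <= (m + K) * n.+1%:R^-1.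
  have numD v : complex.Re (inner (D v) v) = m * nrm v ^+ 2 - num v.
    by rewrite innerBl innerZl ReB Re_realM -nrm_sqr.
  apply: le_trans (@nrm_sqr_le_form _ _ D _ (u n) lD sD L0 DL _) _.
    move=> k /=; rewrite numD subr_ge0; apply: m_ub.
    exact: NB (uN n) (NZ _ _ (NB _ _ (NZ _ _ (uN n)) (BN _ (uN n)))).
  rewrite ler_pM2l// numD u1 expr1n mulr1.
  by have [_ _] := uP n; rewrite lerBlDr addrC -lerBlDr.
have m40 : 0 < m / 4 by rewrite divr_gt0.
have [s0 s0P] := cB _ m40; have [s [us os s0s]] := gram_schmidt s0.
have B_le x : nrm (B x) <= m / 4 * nrm x + K * \sum_(v <- s) nrm (inner x v).
  pose p := \sum_(v <- s) inner x v *: v.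
  have sT v : v \in s -> [set` s] v by [].
  have -> : B x = B (x - p) + B p by rewrite -(lin_mapD lB) subrK.
  rewrite (le_trans (ler_nrmD _ _))// lerD//.
    have xp : nrm (x - p) <= nrm x.
      apply: le_of_sqr; first exact: nrm_ge0.
      rewrite (nrm_sqr_proj os us sT x) lerDl sumr_ge0// => v _.
      exact: sqr_ge0.
    apply: le_trans (ler_wpM2l (ltW m40) xp); apply: s0P; apply: s0s => v vs.
    by rewrite innerBl (inner_comb os us sT _ vs) subrr.
  rewrite (le_trans (BK _))// ler_pM2l// (le_trans (ler_nrm_sum _ _ _))//.
  rewrite big_seq [leRHS]big_seq ler_sum// => v vs; rewrite nrmZ.
  have v1 : nrm v = 1 := orthonormal_nrm os vs.
  by rewrite v1 mulr1.
have [G [UG finG]] := @ultraFilterLemma nat \oo _.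
have Gcof n : G [set k | (n <= k)%N] by apply: finG; exists n.
have [e e0|l ul] := @cauchy_filter_cvg _ _ _ G u _.
  pose e' := m * e / 4; have e'0 : 0 < e' by rewrite divr_gt0// mulr_gt0.
  pose c := K * (size s)%:R + 1.
  have c0 : 0 < c by rewrite ltr_wpDl// mulr_ge0 ?(ltW K0).
  have ec0 : 0 < e' / c by rewrite divr_gt0.
  have u_le1 n : nrm (u n) <= 1 by rewrite u1.
  have [A GA AP] := ultra_inner_cvg s UG u_le1 ec0.
  have em0 : 0 < e' ^+ 2 / (m + K) by rewrite divr_gt0// exprn_gt0.
  have [n nP] := invS_le_eps em0.
  have Du k : (n <= k)%N -> nrm (D (u k)) <= e'.
    move=> /nP kP; apply: le_of_sqr; first exact: ltW.
    by rewrite (le_trans (D_approx k))// mulrC -ler_pdivlMr.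
  exists (A `&` [set k | (n <= k)%N]); first exact: filterI.
  move=> i j [Ai ni] [Aj nj].
  have mu : m * nrm (u i - u j) <= nrm (B (u i - u j)) + (e' + e').
    rewrite -{1}(gtr0_norm m0) -nrm_real -nrmZ.
    have -> : m%:C *: (u i - u j) = B (u i - u j) + (D (u i) - D (u j)).
      by rewrite -(lin_mapB lD) /D [RHS]addrC subrK.
    rewrite (le_trans (ler_nrmD _ _))// lerD2l (le_trans (ler_nrmB _ _))//.
    by rewrite lerD// Du.
  have sumle : K * \sum_(v <- s) nrm (inner (u i - u j) v) <= e'.
    rewrite (@le_trans _ _ (K * \sum_(v <- s) (e' / c)))//.
      by rewrite ler_pM2l// big_seq [leRHS]big_seq ler_sum// => v; exact: AP.
    rewrite big_const_seq count_predT iter_addr_0 -mulr_natr.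
    rewrite [leLHS](_ : _ = e' * (K * (size s)%:R / c)); last by ring.
    by rewrite ler_piMr ?(ltW e'0)// ler_pdivrMr// mul1r lerDl.
  rewrite -(ler_pM2l m0); have := le_trans mu (lerD (B_le _) (lexx _)).
  move: sumle; rewrite /e'.
  move: (nrm (u i - u j)) (K * \sum_(v <- s) nrm (inner (u i - u j) v)).
  by move=> a b; lra.
have l1 : nrm l = 1.
  apply/eqP; rewrite eq_le; apply/andP; split; apply/ler_addgt0Pr => e e0.
    have /filter_ex[n /= h] := ul _ e0; rewrite -(u1 n) -[l](subrK (u n)).
    by rewrite addrC (le_trans (ler_nrmD _ _))// lerD2l nrm_distC.
  have /filter_ex[n /= h] := ul _ e0; rewrite -(u1 n) -[u n](subrK l).
  by rewrite addrC (le_trans (ler_nrmD _ _))// lerD2l.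
exists l, m; split.
- move=> v Fv; apply/eqP; rewrite -nrm_eq0 eq_le nrm_ge0 andbT.
  apply: eq0_le_eps => e e0.
  have v0 : 0 < nrm v + 1 by rewrite ltr_wpDl ?nrm_ge0.
  have ev0 : 0 < e / (nrm v + 1) by rewrite divr_gt0.
  have /filter_ex[n /= h] := ul _ ev0.
  have -> : inner l v = - inner (u n - l) v.
    by rewrite innerBl (uN n v Fv) sub0r opprK.
  rewrite nrmN (le_trans (cauchy_schwarz _ _))//.
  rewrite (le_trans (ler_wpM2r (nrm_ge0 _) h))// -mulrA ler_piMr ?(ltW e0)//.
  by rewrite mulrC ler_pdivrMr// mul1r lerDl.
- by rewrite -nrm_eq0 l1 oner_eq0.
- apply/esym/eqP; rewrite -subr_eq0 -/(D l) -nrm_eq0 eq_le nrm_ge0 andbT.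
  apply: eq0_le_eps => e e0.
  have el0 : 0 < e / 2 / (m + K) by rewrite !divr_gt0.
  have em0 : 0 < (e / 2) ^+ 2 / (m + K).
    by rewrite divr_gt0// exprn_gt0// divr_gt0.
  have [n nP] := invS_le_eps em0.
  have /filter_ex[k [/= h /nP kn]] :
      G ([set i | nrm (u i - l) <= e / 2 / (m + K)] `&` [set k | (n <= k)%N]).
    by apply: filterI; [exact: ul|exact: Gcof].
  have -> : D l = D (u k) - D (u k - l).
    by rewrite (lin_mapB lD) opprB addrC subrK.
  rewrite (le_trans (ler_nrmB _ _))// [e in leRHS]splitr lerD//.
    apply: le_of_sqr; first by rewrite divr_ge0// ltW.
    by rewrite (le_trans (D_approx k))// mulrC -ler_pdivlMr.
  by rewrite (le_trans (DL _))// mulrC -ler_pdivlMr.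
Qed.

(** Maximal orthonormal sets of eigenvectors are bases: the orthocomplement of
    such a set is invariant and contains no eigenvector. *)
Theorem spectral_basis B : positive_op B -> compact_op B ->
  exists2 E, orthonormal_basis E &
    forall e, E e -> exists a : R, B e = a%:C *: e.
Proof.
move=> pB cB; have sB := positive_self_adjoint pB.
pose P E := [/\ forall e, E e -> inner e e = 1,
  forall e e', E e -> E e' -> e != e' -> inner e e' = 0 &
  forall e, E e -> exists a : R, B e = a%:C *: e].
have [C CP Ctot|E [[E1 E0 EB] maxE]] := @Zorn_bigcup _ P.
  split=> [e [X /CP[X1 _ _]]|e e' [X CX Xe] [Y CY Ye']|e [X /CP[_ _]]];
    [exact: X1| |by apply].
  have [XY|YX] := Ctot X Y CX CY.
    by have [_ + _] := CP Y CY; apply => //; exact: XY.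
  by have [_ + _] := CP X CX; apply => //; exact: YX.
exists E => //; split=> // y yE; apply: contrapT => /eqP y0.
have BN x : orthocompl E x -> orthocompl E (B x).
  by move=> Nx e Ee; have [a Be] := EB e Ee; rewrite sB Be innerZr Nx ?mulr0.
have [x [a [Nx x0 Bx]]] : exists x (a : R),
    [/\ orthocompl E x, x != 0 & B x = a%:C *: x].
  have [By|By0] := eqVneq (B y) 0; last first.
    by apply: compact_eigenvector => //; exists y.
  by exists y, 0; split=> //; rewrite By scale0r.
have nx : 0 < nrm x by rewrite lt_def nrm_ge0 nrm_eq0 x0.
pose e := (nrm x)^-1%:C *: x.
have e1 : inner e e = 1.
  rewrite inner_nrm nrmZ nrm_real gtr0_norm ?invr_gt0// mulVf ?gt_eqF//.
  by rewrite expr1n.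
have eE v : E v -> inner e v = 0 by move=> Ev; rewrite innerZl Nx// mulr0.
apply: (maxE (E `|` [set e])).
  split=> [v|]; first by left.
  by move=> /(_ e (or_intror erefl)) /eE/eqP; rewrite e1 oner_eq0.
split=> [v [/E1//|->//]|v w [Ev|->] [Ew|->]|v [/EB//|->]].
- exact: E0.
- by move=> _; apply: inner_eq0C; exact: eE.
- by move=> _; exact: eE.
- by rewrite eqxx.
- by exists a; rewrite (lin_mapZ pB.1.1) Bx !scalerA mulrC.
Qed.

End compact_operators.

(** * Traces of powers of compact operators *)

Section traces.
Context {R : realType} {H : hilbertType R}.
Implicit Types (x y v w f : H) (A B C D S T X : H -> H) (E F : set H) (p : R).

Lemma real_complexM (a b : R) : (a * b)%:C = a%:C * b%:C.
Proof. exact: rmorphM. Qed.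

Lemma orthonormal_basis_ex : exists E : set H, orthonormal_basis E.
Proof.
have l0 : linear ((fun=> 0) : H -> H) by move=> a x y; rewrite scaler0 addr0.
have [||E bE _] := @spectral_basis R H (fun=> 0).
- split=> [|x]; last by rewrite inner0l.
  by apply: (@bounded_opI _ _ _ 0) => // x; rewrite nrm0 mul0r.
- move=> e e0; exists [::] => x _; rewrite nrm0.
  by rewrite mulr_ge0 ?(ltW e0)// nrm_ge0.
- by exists E.
Qed.

Lemma sqrt_form C x : positive_op C ->
  complex.Re (inner (C x) x) = nrm (op_sqrt C x) ^+ 2.
Proof.
move=> pC; have [pD DD] := op_sqrtP pC.
by rewrite -[in LHS]DD/= (positive_self_adjoint pD) nrm_sqr.
Qed.

Lemma trace_ge0 C : positive_op C -> (0 <= trace C)%E.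
Proof.
by move=> pC; apply: esum_ge0 => x _; rewrite lee_fin positive_Re_ge0.
Qed.

(** Two applications of Parseval to D = sqrt C: the double sum of |<D e, f>|^2
    equals that of |<e, D f>|^2. *)
Lemma trace_basis C F : positive_op C -> orthonormal_basis F ->
  trace C = (\esum_(f in F) (complex.Re (inner (C f) f))%:E)%E.
Proof.
move=> pC bF; rewrite /trace; set E := xget _ _.
have bE : orthonormal_basis E.
  have [E0 bE0] := orthonormal_basis_ex.
  exact: (@xgetPex _ set0 _ (ex_intro _ E0 bE0)).
have [pD _] := op_sqrtP pC.
transitivity (\esum_(e in E) \esum_(f in F)
    (nrm (inner (op_sqrt C e) f) ^+ 2)%:E)%E.
  by apply: eq_esum => e Ee; rewrite sqrt_form// parseval.
rewrite esum_swap; last by move=> i j _ _; rewrite lee_fin sqr_ge0.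
apply: eq_esum => f Ff; rewrite sqrt_form// -(parseval _ bE).
apply: eq_esum => e Ee; rewrite (positive_self_adjoint pD).
by rewrite inner_conj_nrm.
Qed.

Lemma op_pow_positive B p : positive_op B -> 1 <= p -> positive_op (op_pow B p).
Proof.
move=> pB p1; apply: fun_calc_positive pB (op_powP pB p1) _ => t _.
exact: powR_ge0.
Qed.

Lemma trace_pow_eigen B F (a : H -> R) p : positive_op B -> 1 <= p ->
  orthonormal_basis F -> (forall f, F f -> B f = (a f)%:C *: f) ->
  trace (op_pow B p) = (\esum_(f in F) (a f `^ p)%:E)%E.
Proof.
move=> pB p1 bF Ba; rewrite (trace_basis (op_pow_positive pB p1) bF).
have oF := basis_orthonormal bF.
apply: eq_esum => f Ff; have f1 := oF f f Ff Ff; rewrite eqxx in f1.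
have f0 : f != 0.
  apply/eqP => f0; move: f1; rewrite /= f0 inner0l => /esym/eqP.
  by rewrite oner_eq0.
by rewrite (fun_calc_eigen pB (op_powP pB p1) f0 (Ba f Ff)) innerZl f1 mulr1.
Qed.

(** Hilbert-Schmidt operators are compact: if the tail of the sum of |D e|^2
    beyond s0 is at most d, then D is small on the orthocomplement of D s0,
    since <D x, e> = <x, D e>. *)
Lemma hilbert_schmidt_small E D (d : R) : orthonormal_basis E ->
  self_adjoint D ->
  (\esum_(e in E) (nrm (D e) ^+ 2)%:E < +oo)%E -> 0 < d ->
  exists s : seq H, forall x, (forall v, v \in s -> inner x v = 0) ->
    nrm (D x) ^+ 2 <= d * nrm x ^+ 2.
Proof.
move=> bE sD; set c := esum _ _ => c_lt d0.
have c_fin : c \is a fin_num.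
  by rewrite ge0_fin_numE// esum_ge0// => e _; rewrite lee_fin sqr_ge0.
have [_ [X [finX XE] <-] Xd] := ub_ereal_sup_adherent d0 c_fin.
rewrite -/(esum _ _) -/c fsbig_finite// sumEFin in Xd.
set s0 : seq H := fset_set X in Xd.
have us0 : uniq s0 by exact: fset_uniq.
have s0E v : v \in s0 -> E v by rewrite in_fset_set// => /set_mem /XE.
have cE : c = (fine c)%:E by rewrite fineK.
have seq_le s : uniq s -> (forall v, v \in s -> E v) ->
    \sum_(v <- s) nrm (D v) ^+ 2 <= fine c.
  by move=> us sE; rewrite -lee_fin -cE -sumEFin seq_le_esum.
move: Xd; rewrite cE -EFinB lte_fin => Xd.
exists (map D s0) => x xs0.
rewrite -lee_fin -(parseval (D x) bE); apply: esum_le_seq => s us sE.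
rewrite sumEFin lee_fin.
have xD v : v \in s0 -> inner x (D v) = 0.
  by move=> vs0; apply: xs0; exact: map_f.
rewrite (bigID (mem s0))/= big1 ?add0r; last first.
  by move=> v vs0; rewrite sD xD// nrm0 expr0n.
rewrite -big_filter; set t := [seq v <- s | v \notin s0].
have tail : \sum_(v <- t) nrm (D v) ^+ 2 <= d.
  have := @seq_le (t ++ s0); rewrite cat_uniq us0 filter_uniq// big_cat/=.
  rewrite andbT => h.
  have : \sum_(v <- t) nrm (D v) ^+ 2 + \sum_(v <- s0) nrm (D v) ^+ 2 <=
      fine c.
    apply: h.
      by apply/hasPn => v vs0; rewrite mem_filter negb_and negbK vs0.
    by move=> v; rewrite mem_cat mem_filter => /orP[/andP[_ /sE]|/s0E].
  move=> le_c; rewrite -(lerD2r (\sum_(v <- s0) nrm (D v) ^+ 2)).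
  by rewrite (le_trans le_c)// -lerBlDl ltW.
rewrite (@le_trans _ _ ((\sum_(v <- t) nrm (D v) ^+ 2) * nrm x ^+ 2))//.
  rewrite mulr_suml ler_sum// => v _; rewrite sD -exprMn.
  rewrite ler_sqr ?nnegrE ?mulr_ge0 ?nrm_ge0// mulrC.
  exact: cauchy_schwarz.
by rewrite ler_wpM2r ?sqr_ge0.
Qed.

(** If the trace of B^p is finite, the square root of B^p is Hilbert-Schmidt;
    the inequality t <= e + e^(1-p) t^p bounds the quadratic form of B by that
    of B^p. *)
Lemma trace_pow_compact B p : positive_op B -> 1 <= p ->
  (trace (op_pow B p) < +oo)%E -> compact_op B.
Proof.
move=> pB p1 trB; have sB := positive_self_adjoint pB; have lB := pB.1.1.
have [M M0 BM] := bounded_op_nrm pB.1.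
have pC := op_pow_positive pB p1; have fC := op_powP pB p1.
set C := op_pow B p in pC fC trB *.
have [pD _] := op_sqrtP pC; have sD := positive_self_adjoint pD.
have [E bE] := orthonormal_basis_ex.
have trD : (\esum_(e in E) (nrm (op_sqrt C e) ^+ 2)%:E < +oo)%E.
  move: trB; rewrite (trace_basis pC bE); congr (_ < _)%E.
  by apply: eq_esum => e _; rewrite sqrt_form.
move=> r r0; pose e := r ^+ 2 / (2 * M); pose K := (e `^ (p - 1))^-1.
have e0 : 0 < e by rewrite divr_gt0 ?mulr_gt0// exprn_gt0.
have K0 : 0 < K by rewrite invr_gt0 powR_gt0.
have eK0 : 0 < e / K by rewrite divr_gt0.
have [s sP] := hilbert_schmidt_small bE sD trD eK0.
exists s => x /sP; rewrite -sqrt_form// => Cx.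
have young t : 0 <= t -> 0 <= e + K * t `^ p + -1 * t.
  move=> t0; have tp0 := powR_ge0 t p.
  have [te|et] := leP t e.
    by rewrite mulN1r addrAC addr_ge0 ?subr_ge0// mulr_ge0// ltW.
  rewrite mulN1r -addrA addr_ge0 ?(ltW e0)// subr_ge0.
  rewrite -(mulr_powRB1 t0) ?(lt_le_trans ltr01)// mulrCA ler_peMr//.
  rewrite mulrC ler_pdivlMr ?powR_gt0// mul1r.
  by rewrite ge0_ler_powR ?nnegrE ?subr_ge0 ?(ltW e0) ?(ltW et).
have := fun_calc_ge0 x pB fC young.
have := nrm_sqr_le_form (x := x) lB sB M0 BM (fun k => positive_Re_ge0 _ pB).
set b := complex.Re (inner (B x) x); set c := complex.Re _ in Cx *.
move=> Bx h; apply: le_of_sqr; first by rewrite mulr_ge0 ?nrm_ge0// ltW.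
have KC : K * c <= e * nrm x ^+ 2.
  rewrite (le_trans (ler_wpM2l (ltW K0) Cx))// mulrC mulrAC divfK//.
  by rewrite gt_eqF.
have : b <= 2 * e * nrm x ^+ 2 by lra.
move=> /(ler_wpM2l (ltW M0)) hb; rewrite (le_trans (le_trans Bx hb))//.
have Me : M * (2 * e) = r ^+ 2 by rewrite /e; field; rewrite gt_eqF.
by rewrite mulrA Me exprMn.
Qed.

(** * Dominated sums and singular values *)

(** With B f = a f *: f on a basis, S f = a f *: h f with h satisfying Bessel's
    inequality, and |<S u_i, v_i>| <= sum_f w_{i f} a_f for the weights
    w_{i f} = (|<u_i, f>|^2 + |<h f, v_i>|^2) / 2, whose row and column sums are
    at most 1. Convexity of t^p, in the form of its tangent lines, concludes. *)
Theorem dominated_pow_sum (I : choiceType) (D : set I) (u v : I -> H) B S p :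
  positive_op B -> compact_op B -> 1 <= p -> bounded_op S ->
  (forall x, nrm (S x) <= nrm (B x)) ->
  orthonormal_on D u -> orthonormal_on D v ->
  (\esum_(i in D) (nrm (inner (S (u i)) (v i)) `^ p)%:E <=
   trace (op_pow B p))%E.
Proof.
move=> pB cB p1 bS SB ou ov; have lS := bS.1; have lB := pB.1.1.
have [F bF BF] := spectral_basis pB cB; have oF := basis_orthonormal bF.
have nF f : F f -> nrm f = 1 by exact: (orthonormal_nrm oF).
have /choice[a aP] : forall f, exists a : R, F f -> B f = a%:C *: f.
  move=> f; have [/BF[a Ba]|nFf] := pselect (F f); first by exists a.
  by exists 0.
have a0 f : F f -> 0 <= a f.
  move=> Ff; have := positive_Re_ge0 f pB.
  by rewrite aP// innerZl Re_realM -nrm_sqr nF// expr1n mulr1.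
have Bf f : F f -> nrm (B f) = a f.
  by move=> Ff; rewrite aP// nrmZ nrm_real nF// mulr1 ger0_norm// a0.
rewrite (trace_pow_eigen pB p1 bF aP).
(* where a f = 0, the inverse is 0 and so is S f *)
pose h f := (a f)^-1%:C *: S f.
have Sh f : F f -> S f = (a f)%:C *: h f.
  move=> Ff; rewrite /h scalerA -real_complexM.
  have [a_0|aN0] := eqVneq (a f) 0; last by rewrite divff// scale1r.
  rewrite a_0 mul0r scale0r; apply/eqP; rewrite -nrm_eq0 eq_le nrm_ge0 andbT.
  by rewrite (le_trans (SB f))// Bf// a_0.
have h1 f : F f -> nrm (h f) <= 1.
  move=> Ff; rewrite nrmZ nrm_real ger0_norm ?invr_ge0 ?a0//.
  have [->|aN0] := eqVneq (a f) 0; first by rewrite invr0 mul0r.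
  rewrite mulrC ler_pdivrMr ?lt_def ?aN0 ?a0// mul1r.
  by rewrite (le_trans (SB f))// Bf.
(* test S on the vector x of coordinates conj <h f, y> / a f *)
have bessel_h y : (\esum_(f in F) (nrm (inner (h f) y) ^+ 2)%:E <=
    (nrm y ^+ 2)%:E)%E.
  apply: esum_le_seq => s us sF; rewrite sumEFin lee_fin.
  set t := \sum_(_ <- _) _.
  pose z f := conjc (inner (h f) y) * (a f)^-1%:C.
  pose x := \sum_(f <- s) z f *: f.
  have Sx : inner (S x) y = t%:C.
    rewrite /x (lin_map_sum lS) inner_suml rmorph_sum/=; apply: eq_bigr => f _.
    by rewrite (lin_mapZ lS) -scalerA innerZl mulrC mulcJ.
  have Bx : nrm (B x) ^+ 2 <= t.
    have -> : B x = \sum_(f <- s) (z f * (a f)%:C) *: id f.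
      rewrite /x (lin_map_sum lB) big_seq [RHS]big_seq; apply: eq_bigr => f fs.
      by rewrite (lin_mapZ lB) aP ?scalerA//; exact: sF.
    rewrite (nrm_comb oF us sF) ler_sum// => f _.
    rewrite ler_sqr ?nnegrE ?nrm_ge0// /z -mulrA -real_complexM nrmM nrm_conjc.
    rewrite nrm_real ler_piMr ?nrm_ge0//.
    have [->|aN0] := eqVneq (a f) 0; first by rewrite mulr0 normr0.
    by rewrite mulVf// normr1.
  have t0 : 0 <= t by rewrite sumr_ge0// => f _; exact: sqr_ge0.
  have : t ^+ 2 <= t * nrm y ^+ 2.
    rewrite (@le_trans _ _ (nrm (B x) ^+ 2 * nrm y ^+ 2))//; last first.
      by rewrite ler_wpM2r ?sqr_ge0.
    rewrite -exprMn ler_sqr ?nnegrE ?mulr_ge0 ?nrm_ge0//.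
    rewrite -[t]ger0_norm// -nrm_real -Sx (le_trans (cauchy_schwarz _ _))//.
    by rewrite ler_wpM2r ?nrm_ge0// SB.
  have [->|tN0] := eqVneq t 0; first by rewrite sqr_ge0.
  by rewrite expr2 ler_pM2l// lt_def tN0.
pose w i f := (nrm (inner (u i) f) ^+ 2 + nrm (inner (h f) (v i)) ^+ 2) / 2.
have w0 i f : 0 <= w i f by rewrite divr_ge0// addr_ge0// sqr_ge0.
have half (J : choiceType) (A : set J) (b c : J -> R) :
    (forall j, 0 <= b j) -> (forall j, 0 <= c j) ->
    (\esum_(j in A) (b j)%:E <= 1)%E -> (\esum_(j in A) (c j)%:E <= 1)%E ->
    (\esum_(j in A) ((b j + c j) / 2)%:E <= 1)%E.
  move=> b0 c0 b1 c1.
  rewrite (@eq_esum _ _ _ _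
    (fun j => (2^-1)%:E * ((b j)%:E + (c j)%:E))%E); last first.
    by move=> j _; rewrite -EFinD -EFinM mulrC.
  rewrite esumZl ?invr_ge0//; last by move=> j _; rewrite adde_ge0// lee_fin.
  rewrite esumD => [|j _|j _]; rewrite ?lee_fin//.
  rewrite (@le_trans _ _ ((2^-1)%:E * (1 + 1))%E)//.
    by rewrite lee_wpmul2l ?lee_fin ?invr_ge0// leeD.
  by rewrite -EFinD -EFinM lee_fin mulVf.
have nu i : D i -> nrm (u i) = 1 by exact: orthonormal_nrm.
have nv i : D i -> nrm (v i) = 1 by exact: orthonormal_nrm.
have row i : D i -> (\esum_(f in F) (w i f)%:E <= 1)%E.
  move=> Di; apply: half => [j|j||]; try exact: sqr_ge0.
    by rewrite (le_trans (bessel (u i) oF))// nu// expr1n.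
  by rewrite (le_trans (bessel_h (v i)))// nv// expr1n.
have col f : F f -> (\esum_(i in D) (w i f)%:E <= 1)%E.
  move=> Ff; apply: half => [j|j||]; try exact: sqr_ge0.
    under eq_esum do rewrite inner_conj_nrm.
    by rewrite (le_trans (bessel f ou))// nF// expr1n.
  rewrite (le_trans (bessel (h f) ov))// lee_fin -(expr1n _ 2).
  by rewrite ler_sqr ?nnegrE ?nrm_ge0// h1.
have entry i : D i -> ((nrm (inner (S (u i)) (v i)) `^ p)%:E <=
    \esum_(f in F) (w i f * a f `^ p)%:E)%E.
  move=> Di; set al := nrm _.
  have al0 : 0 <= al by exact: nrm_ge0.
  have al_le : (al%:E <= \esum_(f in F) (w i f * a f)%:E)%E.
    rewrite /al (adjointE _ _ bS) (le_trans (inner_le_esum _ _ bF))//.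
    apply: le_esum => f Ff; rewrite lee_fin -(adjointE _ _ bS) Sh// innerZl.
    rewrite nrmM nrm_real ger0_norm ?a0// mulrCA mulrC ler_wpM2r ?a0//.
    rewrite /w ler_pdivlMr//.
    have := sqr_ge0 (nrm (inner (u i) f) - nrm (inner (h f) (v i))); lra.
  pose k := p * al `^ (p - 1).
  have k0 : 0 <= k by rewrite mulr_ge0 ?powR_ge0// (le_trans ler01).
  set X := (X in (_ <= X)%E).
  have X0 : (0 <= X)%E.
    by apply: esum_ge0 => f _; rewrite lee_fin mulr_ge0 ?powR_ge0.
  have kal : (k * al = p * al `^ p)%R.
    by rewrite /k -mulrA [_ * al]mulrC mulr_powRB1// (lt_le_trans ltr01).
  have : ((p * al `^ p)%:E <= X + ((p - 1) * al `^ p)%:E)%E.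
    rewrite -kal EFinM.
    rewrite (le_trans (lee_wpmul2l _ al_le)) ?lee_fin//.
    rewrite -esumZl//; last by move=> f Ff; rewrite lee_fin mulr_ge0 ?a0.
    apply: (@le_trans _ _ (\esum_(f in F) ((w i f * a f `^ p)%:E +
        ((p - 1) * al `^ p)%:E * (w i f)%:E))%E).
      apply: le_esum => f Ff; rewrite -!EFinM -EFinD lee_fin.
      rewrite mulrCA [X in _ + X]mulrC -mulrDr ler_wpM2l//.
      by apply: powR_tangent => //; exact: a0.
    have pal0 : 0 <= (p - 1) * al `^ p by rewrite mulr_ge0 ?powR_ge0// subr_ge0.
    rewrite esumD => [|f _|f _]; last 2 first.
    - by rewrite lee_fin mulr_ge0// powR_ge0.
    - by rewrite -EFinM lee_fin mulr_ge0.
    rewrite leeD2l// esumZl// => [|f _]; last by rewrite lee_fin.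
    by rewrite -[leRHS]mule1 lee_wpmul2l ?lee_fin// row.
  case: X X0 => [r r0|_ _|//]; last by rewrite leey.
  by rewrite -EFinD !lee_fin; lra.
apply: (@le_trans _ _ (\esum_(i in D) \esum_(f in F) (w i f * a f `^ p)%:E)%E).
  exact: le_esum.
rewrite esum_swap; last first.
  by move=> i f _ _; rewrite lee_fin mulr_ge0// powR_ge0.
apply: le_esum => f Ff.
under eq_esum do rewrite mulrC EFinM.
rewrite esumZl ?powR_ge0//; last by move=> i _; rewrite lee_fin.
by rewrite -[leRHS]mule1 lee_wpmul2l ?lee_fin ?powR_ge0// col.
Qed.

Lemma op_absP X : bounded_op X ->
  positive_op (op_abs X) /\
  forall x y, inner (op_abs X x) (op_abs X y) = inner (X x) (X y).
Proof.
move=> bX; have baX := adjoint_bounded bX.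
have pG : positive_op (adjoint X \o X).
  split.
    have [K K0 XK] := bounded_op_nrm bX; have [L L0 aXL] := bounded_op_nrm baX.
    apply: (@bounded_opI _ _ _ (L * K)).
      by move=> a x y /=; rewrite bX.1 baX.1.
    move=> x /=; rewrite (le_trans (aXL _))// -mulrA ler_pM2l//.
  by move=> x /=; rewrite -adjointEr// inner_nrm ler0c sqr_ge0.
have [pD DD] := op_sqrtP pG; split=> // x y.
rewrite -(positive_self_adjoint pD) -[LHS]/(inner ((op_abs X \o op_abs X) x) y).
by rewrite [op_abs X \o op_abs X]DD /= -adjointEr.
Qed.

Lemma op_abs_nrm X x : bounded_op X -> nrm (op_abs X x) = nrm (X x).
Proof.
move=> /op_absP[_ XX]; apply/eqP; rewrite -(@eqrXn2 _ 2) ?nrm_ge0//.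
by rewrite !nrm_sqr XX.
Qed.

(** Singular value decomposition: u and v run through the right and left
    singular vectors with nonzero singular value. *)
Lemma singular_values X p : bounded_op X -> compact_op X -> 1 <= p ->
  exists (D : set H) (u v : H -> H), [/\ orthonormal_on D u,
    orthonormal_on D v &
    (trace (op_pow (op_abs X) p) =
     \esum_(i in D) (nrm (inner (X (u i)) (v i)) `^ p)%:E)%E].
Proof.
move=> bX cX p1; have [pB BB] := op_absP bX; set B := op_abs X in pB BB *.
have cB : compact_op B.
  by apply: compact_op_le cX => x; rewrite op_abs_nrm.
have [F bF BF] := spectral_basis pB cB; have oF := basis_orthonormal bF.
have /choice[a aP] : forall f, exists a : R, F f -> B f = a%:C *: f.
  move=> f; have [/BF[a Ba]|nFf] := pselect (F f); first by exists a.
  by exists 0.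
have XX f g : F f -> F g -> inner (X f) (X g) = (a f * a g)%:C * (f == g)%:R.
  move=> Ff Fg; rewrite -BB !aP// innerZl innerZr conjc_real mulrA.
  by rewrite -real_complexM oF.
pose v f := (a f)^-1%:C *: X f.
exists (F `&` [set f | a f != 0]), id, v; split.
- by move=> f g [Ff _] [Fg _]; exact: oF.
- move=> f g [Ff /= af] [Fg /= ag]; rewrite innerZl innerZr conjc_real XX//.
  rewrite !mulrA -!real_complexM.
  have [<-|_] := eqVneq f g; last by rewrite !mulr0.
  by rewrite mulr1 [X in X%:C](_ : _ = 1)//; field.
- rewrite (trace_pow_eigen pB p1 bF aP) (esumID [set f | a f != 0]); last first.
    by move=> f _; rewrite lee_fin powR_ge0.
  rewrite [X in (_ + X)%E]esum1 ?adde0.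
    apply: eq_esum => f [Ff /= af]; congr (_ `^ p)%:E.
    rewrite innerZr conjc_real XX// eqxx mulr1 -real_complexM nrm_real.
    rewrite mulrA mulVf// mul1r ger0_norm//.
    have := positive_Re_ge0 f pB; rewrite aP// innerZl Re_realM oF// eqxx/=.
    by rewrite mulr1.
  move=> f [_ /= /negP]; rewrite negbK => /eqP ->; rewrite powR0//.
  by rewrite gt_eqF// (lt_le_trans ltr01).
Qed.

End traces.

(** * Schatten norms of linear combinations *)

Section schatten.
Context {R : realType} {H : hilbertType R}.
Implicit Types (x y : H) (S X B : H -> H) (p : R) (d : nat).

Lemma ler_schatten_pow p (a b : \bar R) : 1 <= p -> (0 <= a)%E -> (a <= b)%E ->
  (poweR a p^-1 <= poweR b p^-1)%E.
Proof.
move=> p1 a0 ab; apply: gt0_ler_poweR => //.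
- by rewrite invr_ge0 (le_trans ler01).
- by rewrite in_itv/= a0 leey.
- by rewrite in_itv/= (le_trans a0 ab) leey.
Qed.

(** The sum of the p-th powers of the singular values of S is the left-hand side
    of dominated_pow_sum at its singular vectors; no comparison of |S| with B as
    operators is involved. *)
Lemma schatten_norm_le_dominating S B p : bounded_op S -> positive_op B ->
  compact_op B -> 1 <= p -> (forall x, nrm (S x) <= nrm (B x)) ->
  (schatten_norm p S <= poweR (trace (op_pow B p)) p^-1)%E.
Proof.
move=> bS pB cB p1 SB; have cS := compact_op_le SB cB.
have [D [u [v [ou ov trE]]]] := singular_values bS cS p1.
have pS := op_pow_positive (op_absP bS).1 p1.
apply: ler_schatten_pow => //; first exact: trace_ge0.
by rewrite trE; exact: dominated_pow_sum.
Qed.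

(** Convexity of t^p at the midpoint, from the tangent at the midpoint. *)
Lemma powR_midpoint p (s t : R) : 1 <= p -> 0 <= s -> 0 <= t ->
  ((s + t) / 2) `^ p <= (s `^ p + t `^ p) / 2.
Proof.
move=> p1 s0 t0; set m := (s + t) / 2.
have m0 : 0 <= m by rewrite divr_ge0// addr_ge0.
have := powR_tangent p1 m0 s0; have := powR_tangent p1 m0 t0.
rewrite -[m `^ p](mulr_powRB1 m0) ?(lt_le_trans ltr01)//.
have -> : t = 2 * m - s by rewrite /m; field.
move: (m `^ (p - 1)) (s `^ p) (_ `^ p) => q a b; lra.
Qed.

(** At the singular vectors u, v of the real part of c S with |c| = 1, the
    singular value is at most (|<S u, v>| + |<S v, u>|) / 2. *)
Lemma schatten_norm_re S p (c : R[i]) :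
  bounded_op S -> compact_op S -> 1 <= p -> nrm c = 1 ->
  (schatten_norm p (op_re (fun x => c *: S x)) <= schatten_norm p S)%E.
Proof.
move=> bS cS p1 c1; pose X x := c *: S x; rewrite -/X.
have bX : bounded_op X.
  have [K K0 SK] := bounded_op_nrm bS.
  apply: (@bounded_opI _ _ _ K); last by move=> x; rewrite nrmZ c1 mul1r.
  by move=> a x y; rewrite /X bS.1 scalerDr !scalerA mulrC.
have baX := adjoint_bounded bX.
have cX : compact_op X by exact: compact_opZ.
pose A := op_re X; rewrite -/A.
have bA : bounded_op A.
  have [K K0 XK] := bounded_op_nrm bX; have [L L0 aXL] := bounded_op_nrm baX.
  apply: (@bounded_opI _ _ _ (nrm (2^-1 : R[i]) * (K + L))).
    move=> a x y; rewrite /A /op_re bX.1 baX.1 addrACA -scalerDr [LHS]scalerDr.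
    by rewrite !scalerA mulrC.
  move=> x; rewrite nrmZ -mulrA ler_wpM2l ?nrm_ge0//.
  by rewrite (le_trans (ler_nrmD _ _))// mulrDl lerD.
have cA : compact_op A.
  by apply: compact_opZ; apply: compact_opD => //; exact: compact_adjoint.
have [D [u [v [ou ov trE]]]] := singular_values bA cA p1.
have [pB _] := op_absP bS.
have cB : compact_op (op_abs S).
  by apply: compact_op_le cS => x; rewrite op_abs_nrm.
have SB x : nrm (S x) <= nrm (op_abs S x) by rewrite op_abs_nrm.
have half0 : 0 <= 2^-1 :> R by rewrite invr_ge0.
have nhalf : nrm (2^-1 : R[i]) = 2^-1 :> R.
  have -> : (2^-1 : R[i]) = (2^-1 : R)%:C by rewrite real_complexV rmorph_nat.
  by rewrite nrm_real ger0_norm.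
apply: ler_schatten_pow => //.
  exact/trace_ge0/(op_pow_positive (op_absP bA).1 p1).
rewrite trE; pose s i := nrm (inner (S (u i)) (v i)).
pose t i := nrm (inner (S (v i)) (u i)).
have s0 i : 0 <= s i by exact: nrm_ge0.
have t0 i : 0 <= t i by exact: nrm_ge0.
apply: (@le_trans _ _ (\esum_(i in D)
    ((2^-1)%:E * ((s i `^ p)%:E + (t i `^ p)%:E)))%E).
  apply: le_esum => i Di; rewrite -EFinD -EFinM lee_fin mulrC.
  apply: le_trans (powR_midpoint p1 (s0 i) (t0 i)).
  have p0 : 0 <= p by exact: le_trans p1.
  rewrite ge0_ler_powR ?nnegrE ?nrm_ge0 ?divr_ge0 ?addr_ge0//.
  rewrite -[A (u i)]/(2^-1 *: (X (u i) + adjoint X (u i))) innerZl nrmM nhalf.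
  rewrite mulrC ler_wpM2r// innerDl.
  rewrite (le_trans (ler_nrmD _ _))// lerD//.
    by rewrite innerZl nrmM c1 mul1r.
  by rewrite -adjointEr// inner_conj_nrm innerZl nrmM c1 mul1r.
rewrite esumZl//; last by move=> i _; rewrite -EFinD lee_fin addr_ge0 ?powR_ge0.
rewrite esumD => [|i _|i _]; rewrite ?lee_fin ?powR_ge0//.
set tr := trace _; apply: (@le_trans _ _ ((2^-1)%:E * (tr + tr))%E).
  by rewrite lee_wpmul2l ?lee_fin// leeD//; exact: dominated_pow_sum.
have tr0 : (0 <= tr)%E by exact/trace_ge0/op_pow_positive.
case: tr tr0 => [r r0|_|//]; last by rewrite leey.
by rewrite -EFinD -EFinM lee_fin; lra.
Qed.

Lemma numerical_radius_le S p : bounded_op S -> compact_op S -> 1 <= p ->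
  (numerical_radius p S <= schatten_norm p S)%E.
Proof.
move=> bS cS p1; apply: ge_ereal_sup => _ [t _ <-].
apply: schatten_norm_re => //; apply/eqP.
by rewrite -(@eqrXn2 _ 2) ?nrm_ge0// expr1n nrm_sqrE/= cos2Dsin2.
Qed.

Lemma sum_sqr_le (I : finType) (a b : I -> R) : \sum_i a i ^+ 2 <= 1 ->
  (\sum_i a i * b i) ^+ 2 <= \sum_i b i ^+ 2.
Proof.
move=> a1; set c := \sum_i _ * _.
have : 0 <= \sum_i (c * a i - b i) ^+ 2.
  by rewrite sumr_ge0// => i _; exact: sqr_ge0.
have -> : \sum_i (c * a i - b i) ^+ 2 =
    c ^+ 2 * (\sum_i a i ^+ 2) - 2 * c * c + \sum_i b i ^+ 2.
  rewrite [2 * c * c]mulr_sumr mulr_sumr -sumrB -big_split/=.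
  by apply: eq_bigr => i _; ring.
have := ler_wpM2l (sqr_ge0 c) a1; lra.
Qed.

Section spherical_modulus.
Variables (d : nat) (T : 'I_d -> H -> H).
Hypothesis bT : forall i, bounded_op (T i).

Lemma gram_form x : inner (gram T x) x = (\sum_(i < d) nrm (T i x) ^+ 2)%:C.
Proof.
rewrite inner_suml rmorph_sum/=; apply: eq_bigr => i _.
by rewrite -adjointEr// inner_nrm.
Qed.

Lemma bounded_op_sum (I : Type) (r : seq I) (F : I -> H -> H) :
  (forall i, bounded_op (F i)) -> bounded_op (fun x => \sum_(i <- r) F i x).
Proof.
move=> bF; elim: r => [|i r [lr br]].
  apply: (@bounded_opI _ _ _ 0) => [a x y|x].
    by rewrite !big_nil scaler0 addr0.
  by rewrite big_nil nrm0 mul0r.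
have [K K0 FK] := bounded_op_nrm (bF i).
have [L L0 FL] := bounded_op_nrm (conj lr br).
apply: (@bounded_opI _ _ _ (K + L)) => [a x y|x].
  by rewrite !big_cons lr (bF i).1 addrACA scalerDr.
by rewrite big_cons mulrDl (le_trans (ler_nrmD _ _))// lerD.
Qed.

Lemma gram_positive : positive_op (gram T).
Proof.
split=> [|x]; last first.
  by rewrite gram_form ler0c sumr_ge0// => i _; exact: sqr_ge0.
apply: bounded_op_sum => i; have baT := adjoint_bounded (bT i).
have [K K0 TK] := bounded_op_nrm (bT i); have [L L0 aTL] := bounded_op_nrm baT.
apply: (@bounded_opI _ _ _ (L * K)) => [a x y|x].
  by rewrite (bT i).1 baT.1.
by rewrite (le_trans (aTL _))// -mulrA ler_pM2l.
Qed.

Lemma nrm_spherical_modulus x :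
  nrm (spherical_modulus T x) ^+ 2 = \sum_(i < d) nrm (T i x) ^+ 2.
Proof. by rewrite -sqrt_form ?gram_form//; exact: gram_positive. Qed.

Lemma lin_comb_bounded l : bounded_op (lin_comb l T).
Proof.
apply: bounded_op_sum => i; have [K K0 TK] := bounded_op_nrm (bT i).
apply: (@bounded_opI _ _ _ (nrm (l i) * K)) => [a x y|x].
  by rewrite (bT i).1 scalerDr !scalerA mulrC.
by rewrite nrmZ -mulrA ler_wpM2l ?nrm_ge0.
Qed.

(** Cauchy-Schwarz in C^d: |sum l_k T_k x|^2 <= sum |T_k x|^2 = |P x|^2. *)
Lemma lin_comb_le_modulus l x : complex_ball l ->
  nrm (lin_comb l T x) <= nrm (spherical_modulus T x).
Proof.
move=> l1; apply: le_of_sqr; first exact: nrm_ge0.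
rewrite nrm_spherical_modulus.
have {}l1 : \sum_(k < d) nrm (l k) ^+ 2 <= 1.
  rewrite -lecR rmorph_sum/= (le_trans _ l1)//.
  by rewrite le_eqVlt; apply/orP; left; apply/eqP; apply: eq_bigr => k _;
    rewrite norm_nrm rmorphXn.
apply: le_trans (sum_sqr_le (fun k => nrm (T k x)) l1).
rewrite ler_sqr ?nnegrE ?nrm_ge0//; last first.
  by rewrite sumr_ge0// => k _; rewrite mulr_ge0 ?nrm_ge0.
rewrite (le_trans (ler_nrm_sum _ _ _))// ler_sum// => k _.
by rewrite nrmZ.
Qed.

End spherical_modulus.

End schatten.

Theorem theorem4p1 (R : realType) (H : hilbertType R)
    (separableH : separable_space H) (d : nat) (p : R) (p_ge1 : 1 <= p)
    (T V : 'I_d -> H -> H) (P : H -> H)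
    (T_class : spherical_schatten_class p T)
    (T_polar : spherical_polar_decomposition T V P) :
  (joint_numerical_radius p T <= hypo_norm p T)%E /\
  (hypo_norm p T <= spherical_schatten_norm p T)%E.
Proof.
have [bT trP] := T_class.
have [pP _] := op_sqrtP (gram_positive bT).
have cP : compact_op (spherical_modulus T) by exact: trace_pow_compact trP.
split; apply: ge_ereal_sup => _ [l l1 <-].
  have cl : compact_op (lin_comb l T).
    by apply: compact_op_le cP => x; exact: lin_comb_le_modulus.
  apply: le_trans (numerical_radius_le (lin_comb_bounded bT l) cl p_ge1) _.
  by apply: ereal_sup_ubound; exists l.
apply: schatten_norm_le_dominating => //; first exact: lin_comb_bounded.
by move=> x; exact: lin_comb_le_modulus.
Qed.
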